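(* Let $\Delta>0$ and $p>0$. Suppose the times at which a web page changes form a time-homogeneous Poisson point process on $[0,\infty)$ with rate $\Delta$, and, independently, the page is accessed at times $0=t_0<t_1<t_2<\cdots$ where $\{t_k-t_{k-1}\}_{k\ge1}$ are i.i.d. exponential random variables with rate $p$. For $k\ge 1$ let $I_k=1$ if the page changed at least once in $(t_{k-1},t_k]$ and $I_k=0$ otherwise. Let $\omega>0$ be a constant, let $\{\beta_k\}_{k\ge -1}$ and $\{\eta_k\}_{k\ge0}$ be sequences of positive reals, set $\gamma_k=\eta_k/\beta_k$ and \[ \zeta_k=\frac{\beta_k-\omega\eta_k}{\beta_{k-1}},\qquad k\ge0, \] let $z_0,z_{-1}\in\mathbb{R}$, and define \[ z_{k+1}=z_k+\eta_k\big[I_{k+1}(z_k+p)-z_k\big]+\zeta_k(z_k-z_{k-1}),\qquad k\ge0. \] Then $z_k\to\Delta$ almost surely, provided one of the following holds: 1. (One-timescale) $\sum_{k\ge0}\beta_k=\infty$, $\sum_{k\ge0}\beta_k^2<\infty$, and $\beta_k=\gamma_k$ for all $k$; 2. (Two-timescale) $\sum_{k\ge0}\beta_k=\sum_{k\ge0}\gamma_k=\infty$, $\sum_{k\ge0}(\beta_k^2+\gamma_k^2)<\infty$, and $\lim_{k\to\infty}\beta_k/\gamma_k=0$.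
   Context: Here $\Delta$ is unknown (to be estimated) and $p$ is known; $z_k$ is called the SAM estimator (stochastic approximation with heavy-ball momentum). *)

(* Defs.v *)
From HB Require Import structures.
From mathcomp Require Import all_boot all_order all_algebra.
From mathcomp Require Import all_classical all_reals all_analysis.
Set Implicit Arguments. Unset Strict Implicit. Unset Printing Implicit Defensive.
Import Order.TTheory GRing.Theory Num.Theory.
Import numFieldNormedType.Exports.
Local Open Scope classical_set_scope.
Local Open Scope ring_scope.

Section defs.
Context {d : measure_display} {T : measurableType d} {R : realType}.
Variable P : probability T R.

Definition is_exponential (rate : R) (X : {RV P >-> R}) : Prop :=
  forall B : set R, measurable B -> P (X @^-1` B) = exponential_prob rate B.

Definition mutually_independent (I : eqType) (X : I -> {RV P >-> R}) : Prop :=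
  forall (s : seq I) (B : I -> set R), uniq s -> (forall i, measurable (B i)) ->
    P (\bigcap_(i in [set` s]) (X i @^-1` B i)) =
    \big[*%E/1%E]_(i <- s) P (X i @^-1` B i).
End defs.

Definition arrival {T : Type} {R : realType} (X : nat -> T -> R) (n : nat) (w : T) : R :=
  \sum_(i < n) X i w.

(* I_k = 1 iff the page changed at least once in (t_{k-1}, t_k], where the
   change times are C_n = arrival S n.+1 (n >= 0) and the access times are
   t_k = arrival A k (t_0 = 0). *)
Definition change_indicator {T : Type} {R : realType}
  (S A : nat -> T -> R) (k : nat) (w : T) : R :=
  if `[< exists n : nat,
         arrival A k.-1 w < arrival S n.+1 w <= arrival A k w >] then 1 else 0.

Definition beta_prev {R : realType} (bm1 : R) (beta : nat -> R) (k : nat) : R :=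
  match k with 0 => bm1 | k'.+1 => beta k' end.

Definition zeta_seq {R : realType} (omega bm1 : R) (beta eta : nat -> R) (k : nat) : R :=
  (beta k - omega * eta k) / beta_prev bm1 beta k.

(* SAM iterates: sam_pair n = (z_{n-1}, z_n) *)
Fixpoint sam_pair {R : realType} (p omega bm1 zm1 z0 : R) (beta eta : nat -> R)
  (I : nat -> R) (n : nat) : R * R :=
  match n with
  | 0 => (zm1, z0)
  | k.+1 =>
    let: (a, b) := sam_pair p omega bm1 zm1 z0 beta eta I k in
    (b, b + eta k * (I k.+1 * (b + p) - b) + zeta_seq omega bm1 beta eta k * (b - a))
  end.

Definition sam {R : realType} (p omega bm1 zm1 z0 : R) (beta eta : nat -> R)
  (I : nat -> R) (n : nat) : R :=
  (sam_pair p omega bm1 zm1 z0 beta eta I n).2.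

(* Main.v *)
(* With x_k = z_k - Delta and y_k = (z_k - z_{k-1}) / beta_{k-1}, the iteration
   becomes the linear system
     y_{k+1} = y_k + gamma_k (- a x_k - omega y_k + xi_k (x_k + c)),
     x_{k+1} = x_k + beta_k y_{k+1},
   where a = p / (p + Delta), c = p + Delta and xi_k = I_{k+1} - Delta / (p + Delta).

   By the memoryless property of the exponential law, given the first k
   indicators and the number of changes before t_k, the next change comes after
   t_{k+1} with probability p / (p + Delta); hence the I_k are i.i.d. Bernoulli
   variables and, sum gamma_k^2 being finite, Kolmogorov's maximal inequality
   makes sum gamma_k xi_k converge almost surely.

   The rest is pathwise. If N_k is the k-th tail of that series, then
   u_k = y_k + N_k (x_k + c) satisfies the system without noise up to an error
   gamma_k o(1 + |x_k| + |u_k|). A Lyapunov function of (x, u) decreases by a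
   multiple of beta_k whenever it exceeds a given delta, so it tends to 0; it is
   a x^2 + u^2/2 + (u + omega x)^2/2 for one timescale, and
   max(|x|, (4/b) |u + b x|) with b = a / omega for two. *)
Require Import Defs.
From HB Require Import structures.
From mathcomp Require Import all_boot all_order all_algebra.
From mathcomp Require Import all_classical all_reals all_analysis.
From mathcomp Require Import measurable_realfun ring lra.
Set Implicit Arguments. Unset Strict Implicit. Unset Printing Implicit Defensive.
Import Order.TTheory GRing.Theory Num.Theory.
Import numFieldNormedType.Exports.
Local Open Scope classical_set_scope.
Local Open Scope ring_scope.

(** * Exponential holding times *)

Lemma exponential_prob_tail (R : realType) (r u : R) : 0 < r -> 0 <= u ->
  exponential_prob r `]u, +oo[ = (expR (- r * u))%:E.
Proof.
move=> r0 u0; rewrite /exponential_prob integral_itv_obnd_cbnd; last first.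
  by apply/measurable_EFinP/measurable_funTS; exact: measurable_exponential_pdf.
have cexp : continuous (fun z : R^o => expR (- r * z)).
  move=> z; apply: continuous_comp; last exact: continuous_expR.
  by apply: continuousM => //; exact: cst_continuous.
rewrite (@ge0_continuous_FTC2y _ _ (fun x => - (expR (- r * x))) _ 0)//.
- by rewrite EFinN oppeK add0e.
- by move=> x _; apply: exponential_pdf_ge0; exact: ltW.
- apply: (@continuous_subspaceW R^o _ _ [set` `[0, +oo[%R]).
    by apply: subset_itvr; rewrite bnd_simp.
  exact: within_continuous_exponential_pdf.
- rewrite -oppr0; apply: cvgN.
  rewrite (_ : (fun x => expR (- r * x)) =
               (fun z => expR (- z)) \o (fun z => r * z)); last first.
    by apply: eq_fun => x; rewrite mulNr.
  apply: (@cvg_comp _ _ _ _ _ _ (pinfty_nbhs R)); last exact: cvgr_expR.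
  exact: gt0_cvgMry.
- by apply: cvgN; apply/cvg_at_right_filter; exact: cexp.
- move=> z; rewrite in_itv/= andbT => uz; apply: derive1_exponential_pdf.
  by rewrite in_itv/= andbT (le_lt_trans u0).
Qed.

Lemma exponential_prob_lt0 (R : realType) (r : R) :
  exponential_prob r `]-oo, 0[ = 0%E.
Proof.
apply: integral0_eq => x /=; rewrite in_itv/= => x0.
by rewrite lt0_exponential_pdf.
Qed.

(* Radon-Nikodym needs Lebesgue measure, which lives on [measurableTypeR R]; its
   display differs from the one of [R]. *)
Lemma exponential_laplace_measurableTypeR (R : realType)
  (m : probability (measurableTypeR R) R) (p r : R) :
  0 < p -> 0 < r ->
  (forall B, measurable B -> m B = exponential_prob p B) ->
  (\int[m]_(x in `[0%R, +oo[) (expR (- r * x))%:E = (p / (p + r))%:E)%E.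
Proof.
move=> p0 r0 mE.
pose f : R -> \bar R := fun x => (expR (- r * x))%:E.
have mexp : measurable_fun setT (fun x : R => expR (- r * x)).
  by apply: measurableT_comp => //; exact: measurable_funM.
have mf D : measurable_fun D f.
  by apply/measurable_EFinP; apply: measurable_funTS.
have f1 x : 0 <= x -> (`|f x| <= 1)%E.
  move=> x0; rewrite lee_fin ger0_norm ?expR_ge0// -expR0 ler_expR.
  by rewrite mulNr oppr_le0 mulr_ge0// ltW.
have itv0P (x : R) : `[0%R, +oo[%classic x -> 0 <= x.
  by rewrite /= in_itv/= andbT.
have mI : measurable (`[0%R, +oo[%classic : set (measurableTypeR R)).
  exact: (@measurable_itv R).
have intf : m.-integrable `[0%R, +oo[ f.
  apply: (@le_integrable _ _ _ _ _ _ _ (cst 1%E)) => //.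
  - exact: mf.
  - by move=> x Dx; have x0 := itv0P _ Dx; rewrite /= normr1 f1.
  - exact: finite_measure_integrable_cst.
have mpdf q D : measurable_fun D (fun x : R => (exponential_pdf q x)%:E).
  apply/measurable_EFinP; apply: measurable_funTS.
  exact: measurable_exponential_pdf.
(* The law is an integral against Lebesgue measure, so the expectation can be rewritten with the
   Radon-Nikodym derivative of [m]. *)
have dom : m `<< (@lebesgue_measure R).
  apply/null_content_dominatesP => A mA A0; rewrite mE//.
  by apply: null_set_integral => //; exact: mpdf.
have -> := esym (@Radon_Nikodym_change_of_variables _ (measurableTypeR R) R m
  (@lebesgue_measure R) dom f _ _ intf) => //.
have mRN : measurable_fun setT
    (Radon_Nikodym (charge_of_finite_measure m) (@lebesgue_measure R)).
  exact: (measurable_int _ (Radon_Nikodym_integrable _)).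
transitivity (\int[lebesgue_measure]_(x in `[0%R, +oo[)
    (f x * (exponential_pdf p x)%:E))%E.
  apply: ae_eq_integral => //.
  - apply: emeasurable_funM; first exact: mf.
    by apply: measurable_funTS; exact: mRN.
  - by apply: emeasurable_funM; [exact: mf|exact: mpdf].
  (* The derivative and the exponential density have the same integral over every measurable set,
     hence agree almost everywhere. *)
  - apply: ae_eqe_mul2l; apply: integral_ae_eq; [exact: mI| |exact: mpdf|].
    + apply: (integrableS measurableT) => //.
      exact: Radon_Nikodym_integrable.
    + by move=> E _ mE'; rewrite -Radon_Nikodym_integral//; exact: mE.
(* The product of the two exponentials is [p / (p + r)] times the density of rate [p + r], whose
   total mass is its tail at 0. *)
transitivity (\int[lebesgue_measure]_(x in `[0%R, +oo[)
    ((p / (p + r))%:E * (exponential_pdf (p + r) x)%:E))%E.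
  apply: eq_integral => x /set_mem Dx; have x0 := itv0P _ Dx.
  rewrite -!EFinM !exponential_pdfE//; congr EFin.
  have -> : - (p + r) * x = - r * x + - p * x by ring.
  rewrite expRD; field.
  by rewrite gt_eqF ?addr_gt0.
rewrite integralZl//=; last first.
  apply: (integrableS measurableT) => //.
  exact/integrable_exponential_pdf/addr_gt0.
rewrite -integral_itv_obnd_cbnd//.
have := @exponential_prob_tail R (p + r) 0 (addr_gt0 p0 r0) (lexx _).
by rewrite /exponential_prob => ->; rewrite mulr0 expR0 mule1.
Qed.

(** The identity, read as a measurable map into [measurableTypeR R], carries the law to the other
    display, and change of variables brings the integral back. *)
Lemma exponential_laplace (R : realType) (m : probability R R) (p r : R) :
  0 < p -> 0 < r ->
  (forall B, measurable B -> m B = exponential_prob p B) ->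
  (\int[m]_(x in `[0%R, +oo[) (expR (- r * x))%:E = (p / (p + r))%:E)%E.
Proof.
move=> p0 r0 mE.
have mid : measurable_fun setT (idfun : R -> measurableTypeR R).
  by move=> _ B mB; rewrite setTI.
pose X : {mfun R >-> measurableTypeR R} :=
  HB.pack (idfun : R -> measurableTypeR R)
    (@isMeasurableFun.Build _ _ R (measurableTypeR R) _ mid).
rewrite -(@exponential_laplace_measurableTypeR _ (distribution m X) p r)//.
rewrite ge0_integral_pushforward//.
apply/measurable_EFinP; apply: measurable_funTS.
by apply: measurableT_comp => //; exact: measurable_funM.
Qed.

(** * Independence of one variable from the sigma-algebra of finitely many others *)

Section sigma_independence.
Context {d : measure_display} {T : measurableType d} {R : realType}.
Variables (P : probability T R) (I : choiceType) (X : I -> {RV P >-> R}).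

(** A pi-system generating the sigma-algebra of the variables indexed by [s]. *)
Definition cylinders (s : seq I) : set (set T) :=
  [set F | exists2 B : I -> set R, (forall i, measurable (B i)) &
     F = \bigcap_(j in [set` s]) (X j @^-1` B j)].

Lemma cylinders_setI s : setI_closed (cylinders s).
Proof.
move=> _ _ [B mB ->] [C mC ->]; exists (fun i => B i `&` C i).
  by move=> i; exact: measurableI.
by rewrite -bigcapI; apply: eq_bigcapr => i _; rewrite preimage_setI.
Qed.

Lemma cylinders_measurable s F : <<s cylinders s >> F -> measurable F.
Proof.
move=> sF; apply: sF; split; last first.
  move=> _ [B mB ->]; apply: fin_bigcap_measurable => // i _.
  by rewrite -[X in measurable X]setTI; exact: measurable_funP.
exact: sigma_algebra_measurable.
Qed.

Lemma cylinders_measurable_fun s i : i \in s ->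
  measurable_fun setT (X i : g_sigma_algebraType (cylinders s) -> R).
Proof.
move=> si _ B mB; rewrite setTI; apply: sub_sigma_algebra.
exists (fun j => if j == i then B else setT); first by move=> j; case: ifP.
apply/seteqP; split => [w Bw j _/=|w /(_ i)/=]; last by rewrite eqxx; exact.
by case: ifPn => // /eqP ->.
Qed.

Hypothesis indX : mutually_independent X.

(** Dynkin's pi-lambda argument: the events satisfying the product rule are closed under complements
    ([QC]) and disjoint unions ([QU]), and they contain the cylinders by mutual independence. *)
Lemma independent_sigma s i F B : i \notin s -> uniq s ->
  <<s cylinders s >> F -> measurable B ->
  P (F `&` X i @^-1` B) = (P F * P (X i @^-1` B))%E.
Proof.
move=> si us + mB.
have mXB : measurable (X i @^-1` B).
  by rewrite -[X in measurable X]setTI; exact: measurable_funP.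
have PB : P (X i @^-1` B) \is a fin_num by exact: fin_num_measure.
have QC (A : set T) : measurable A ->
    P (A `&` X i @^-1` B) = (P A * P (X i @^-1` B))%E ->
    P (~` A `&` X i @^-1` B) = (P (~` A) * P (X i @^-1` B))%E.
  move=> mA QA.
  have -> : ~` A `&` X i @^-1` B = X i @^-1` B `\` (A `&` X i @^-1` B).
    by apply/seteqP; split => w; rewrite /setD/=; tauto.
  rewrite measureD//; last 2 first.
    exact: measurableI.
    by rewrite ltey_eq PB.
  rewrite (setIidr (@subIsetr _ _ _)).
  rewrite [X in (_ - X)%E](_ : _ = P A * P (X i @^-1` B))%E//.
  rewrite probability_setC//.
  by rewrite muleBl ?mul1e// fin_num_measure.
have QU (A : (set T)^nat) : (forall n, measurable (A n)) ->
    trivIset setT A ->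
    (forall n, P (A n `&` X i @^-1` B) = (P (A n) * P (X i @^-1` B))%E) ->
    P (\bigcup_n A n `&` X i @^-1` B) = (P (\bigcup_n A n) * P (X i @^-1` B))%E.
  move=> mA tA QA; rewrite setI_bigcupl !measure_bigcup//=; last 2 first.
    by move=> n _; exact: measurableI.
    exact: trivIset_setIr.
  under eq_eseriesr do rewrite QA -(fineK PB) muleC.
  by rewrite nneseriesZl// fineK// muleC.
pose Q : set (g_sigma_algebraType (cylinders s)) -> Prop := fun F =>
  P (F `&` X i @^-1` B) = (P F * P (X i @^-1` B))%E.
apply: (@dynkin_induction _ (g_sigma_algebraType (cylinders s)) (cylinders s) Q).
- by [].
- exact: cylinders_setI.
- by rewrite /Q setTI probability_setT mul1e.
- move=> _ [C mC ->]; rewrite /Q.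
  (* Intersecting a cylinder over [s] with the event at [i] gives a cylinder over [i :: s];
     [i \notin s] keeps the two choices of sets apart. *)
  have := @indX (i :: s) (fun j => if j == i then B else C j).
  rewrite /= si us => /(_ isT); rewrite big_cons eqxx => E.
  have -> : \bigcap_(j in [set` s]) (X j @^-1` C j) `&` X i @^-1` B =
      \bigcap_(j in [set` i :: s]) (X j @^-1` (if j == i then B else C j)).
    apply/seteqP; split => [w [Cw Bw] j /=|w H].
      rewrite inE => /orP[/eqP ->|js]; first by rewrite eqxx.
      by case: ifPn => [/eqP ->//|_]; exact: Cw.
    split; last by have := H i; rewrite /= eqxx; apply; rewrite inE eqxx.
    move=> j /= js; have := H j; rewrite /= ifN; last first.
      by apply: contraNneq si => <-.
    by apply; rewrite inE js orbT.
  rewrite E; last by move=> j; case: ifP.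
  rewrite muleC; congr (_ * _)%E.
  rewrite indX//; apply: eq_big_seq => j js; rewrite ifN//.
  by apply: contraNneq si => <-.
- by move=> A /cylinders_measurable; exact: QC.
- by move=> A mA; apply: QU => n; apply: cylinders_measurable; exact: mA.
Qed.

End sigma_independence.

Lemma measurable_set_ltr d (T : measurableType d) (R : realType) (f g : T -> R) :
  measurable_fun setT f -> measurable_fun setT g ->
  measurable [set w | f w < g w].
Proof.
move=> mf mg; rewrite (_ : [set w | _] =
    setT `&` (fun w => f w < g w) @^-1` [set true]).
  exact: measurable_fun_ltr.
by apply/seteqP; split => w //= [].
Qed.

Lemma measurable_set_ler d (T : measurableType d) (R : realType) (f g : T -> R) :
  measurable_fun setT f -> measurable_fun setT g ->
  measurable [set w | f w <= g w].
Proof.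
move=> mf mg; rewrite (_ : [set w | _] =
    setT `&` (fun w => f w <= g w) @^-1` [set true]).
  exact: measurable_fun_ler.
by apply/seteqP; split => w //= [].
Qed.

(** * Memorylessness as a race between a holding time and an access time *)

Section exponential_race.
Context {d : measure_display} {T : measurableType d} {R : realType}.
Implicit Types (P : probability T R) (E : set T).

Section restricted_law.
Context {d' : measure_display} {T' : measurableType d'}.
Variables (P : probability T R) (E : set T) (W : {mfun T >-> T'}).
Hypothesis mE : measurable E.

(** An unnormalised conditional law of [W] given [E]: without dividing by [P E], null events need no
    separate treatment. *)
Definition restricted_law : set T' -> \bar R := pushforward (mrestr P mE) W.

Let restricted_law0 : restricted_law set0 = 0%E.
Proof. by rewrite /restricted_law /pushforward preimage_set0 measure0. Qed.

Let restricted_law_ge0 B : (0 <= restricted_law B)%E.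
Proof. exact: measure_ge0. Qed.

Let restricted_law_sigma_additive : semi_sigma_additive restricted_law.
Proof. exact: measure_semi_sigma_additive. Qed.

HB.instance Definition _ := isMeasure.Build _ _ _ restricted_law
  restricted_law0 restricted_law_ge0 restricted_law_sigma_additive.

Let restricted_law_fin : fin_num_fun restricted_law.
Proof.
move=> B mB; rewrite /restricted_law /pushforward /mrestr fin_num_measure//.
by apply: measurableI => //; rewrite -[X in measurable X]setTI; exact: measurable_funP.
Qed.

HB.instance Definition _ :=
  Measure_isFinite.Build _ _ _ restricted_law restricted_law_fin.

Lemma restricted_lawE B : restricted_law B = P (E `&` W @^-1` B).
Proof. by rewrite /restricted_law /pushforward /mrestr setIC. Qed.

End restricted_law.

(* Independence of the pair (E, W) and of Z makes the image of P restricted to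
   E under (W, Z) a product measure. *)
Lemma race_prob P E (W Z : T -> R) (m1 m2 : {finite_measure set R -> \bar R})
    (t : R) :
  measurable E -> measurable_fun setT W -> measurable_fun setT Z ->
  m1 `]-oo, 0[%classic = 0%E ->
  (forall A B, measurable A -> measurable B ->
    P (E `&` (W @^-1` A `&` Z @^-1` B)) = (m1 A * m2 B)%E) ->
  P (E `&` [set w | W w + t < Z w]) =
  (\int[m1]_(w in `[0%R, +oo[) m2 `](w + t)%R, +oo[%classic)%E.
Proof.
move=> mE mW mZ m10 PE.
have mWZ : measurable_fun setT (fun x => (W x, Z x)).
  by apply/measurable_fun_pairP; split.
pose f : {mfun T >-> (R * R)%type} := HB.pack (fun x => (W x, Z x))
    (@isMeasurableFun.Build _ _ T (R * R)%type _ mWZ).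
pose D := [set x : R * R | x.1 + t < x.2].
have mD : measurable D.
  apply: measurable_set_ltr => //.
  by apply: measurable_funD => //; exact: measurable_fst.
have xD w : m2 `](w + t)%R, +oo[%classic = (m2 \o xsection D) w.
  rewrite /=; congr (m2 _); apply/seteqP; split => y /=.
    by rewrite /xsection/= in_itv/= andbT inE.
  by rewrite /xsection/= in_itv/= andbT inE.
transitivity (pushforward (mrestr P mE) f D).
  by rewrite /pushforward /mrestr setIC.
rewrite -(@product_measure_unique _ _ _ _ R m1 m2)//=; last first.
  by move=> A B mA mB; rewrite /pushforward /mrestr setIC PE.
(* [m1] gives no mass to the negative half-line, so the Fubini integral reduces to nonnegative
   [w]. *)
rewrite /product_measure1 (@ge0_negligible_integral _ _ _ m1 setT `]-oo, 0[%classic)//.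
- rewrite setTD setCitvl; apply: eq_integral => x _; exact/esym/xD.
- exact: measurable_fun_xsection.
Qed.

(** Integrating the tail of [X] over the law of [U] on [E] shows that, once [X] has outlasted [U],
    the residual [X - U] is again exponential of rate [r]. It then races [Y], and its tail averaged
    over [Y] is the Laplace transform of [Y] at [r]. *)
Lemma memoryless_race P E (U : T -> R) (X Y : {RV P >-> R}) (r p : R) :
  0 < r -> 0 < p -> measurable E -> measurable_fun setT U ->
  (forall w, E w -> 0 <= U w) ->
  is_exponential r X -> is_exponential p Y ->
  (forall A B, measurable A -> measurable B ->
    P (E `&` (U @^-1` A `&` X @^-1` B)) =
    (P (E `&` U @^-1` A) * P (X @^-1` B))%E) ->
  (forall A B, measurable A -> measurable B ->
    P (E `&` [set w | (U w < X w)%R] `&`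
       (Y @^-1` A `&` (fun w => (X w - U w)%R) @^-1` B)) =
    (P (Y @^-1` A) *
     P (E `&` [set w | (U w < X w)%R] `&` (fun w => (X w - U w)%R) @^-1` B))%E) ->
  P (E `&` [set w | (U w < X w)%R] `&` [set w | U w + Y w < X w]) =
  ((p / (p + r))%:E * P (E `&` [set w | (U w < X w)%R]))%E.
Proof.
move=> r0 p0 mE mU U0 eX eY indX indY.
pose K t := P (E `&` [set w | U w + t < X w]).
pose U' : {mfun T >-> R} := HB.pack U (@isMeasurableFun.Build _ _ T R _ mU).
pose J := (\int[restricted_law P U' mE]_(w in `[0%R, +oo[) (expR (- r * w))%:E)%E.
(* The factor [J] collects everything that depends on [U]; it does not involve [t], so comparing
   with [t = 0] eliminates it. *)
have KE t : 0 <= t -> K t = ((expR (- r * t))%:E * J)%E.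
  move=> t0; rewrite /K (@race_prob P E U X (restricted_law P U' mE) (distribution P X) t)//.
  - rewrite /J -ge0_integralZl_EFin//.
    + apply: eq_integral => w; rewrite inE/= in_itv/= andbT => w0.
      rewrite /distribution /pushforward eX// exponential_prob_tail ?addr_ge0//.
      by rewrite -EFinM -expRD -mulrDr addrC.
    apply/measurable_EFinP; apply: measurable_funTS.
    by apply: measurableT_comp => //; exact: measurable_funM.
  - apply: (etrans (restricted_lawE P U' mE _)); rewrite (_ : _ `&` _ = set0) ?measure0//.
    apply/seteqP; split => // w [/U0 + /=]; rewrite in_itv/= => U0w.
    by rewrite ltNge U0w.
  - by move=> A B mA mB; rewrite indX//; congr (_ * _)%E; exact/esym/restricted_lawE.
have K0 : K 0 = P (E `&` [set w | (U w < X w)%R]).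
  by rewrite /K; congr (P (_ `&` _)); apply/seteqP; split => w /=; rewrite addr0.
have KK0 t : 0 <= t -> K t = ((expR (- r * t))%:E * K 0%R)%E.
  by move=> t0; rewrite !KE// mulr0 expR0 mul1e.
pose E2 := E `&` [set w | U w < X w].
have mE2 : measurable E2.
  by apply: measurableI => //; apply: measurable_set_ltr.
have mZ : measurable_fun setT (fun w => X w - U w).
  by apply: measurable_funB => //; exact: measurable_funPT.
pose Z : {mfun T >-> R} :=
  HB.pack (fun w => X w - U w) (@isMeasurableFun.Build _ _ T R _ mZ).
have Ztail y : 0 <= y -> restricted_law P Z mE2 `]y, +oo[%classic =
    ((expR (- r * y))%:E * K 0%R)%E.
  move=> y0; rewrite -KK0// restricted_lawE /K; congr (P _).
  apply/seteqP; split => w /=; rewrite in_itv/= andbT ltrBrDl.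
    by move=> [[]].
  move=> [Ew UX]; split => //; split => //.
  by apply: le_lt_trans UX; rewrite lerDl.
transitivity (P (E2 `&` [set w | Y w + 0 < Z w])).
  congr (P _); apply/seteqP; split => w /= [E2w];
    by rewrite addr0 ltrBrDl.
rewrite (@race_prob P E2 Y Z (distribution P Y) (restricted_law P Z mE2) 0)//.
- rewrite -K0 -(@exponential_laplace _ (distribution P Y) p r)//.
  rewrite muleC -ge0_integralZl//.
  + apply: eq_integral => y; rewrite inE/= in_itv/= andbT => y0.
    by rewrite addr0 Ztail// muleC.
  + apply/measurable_EFinP; apply: measurable_funTS.
    by apply: measurableT_comp => //; exact: measurable_funM.
- exact: (etrans (eY _ (measurable_itv _)) (exponential_prob_lt0 p)).
- move=> A B mA mB; apply: (etrans (indY _ _ mA mB)); congr (_ * _)%E.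
  exact/esym/restricted_lawE.
Qed.

End exponential_race.

(** * Independence of the change indicators *)

(** A predicate per index, rather than a prescribed bit, lets the same family of events also leave
    indices unconstrained. *)
Lemma measurable_bits d (T : measurableType d) (b : nat -> T -> bool)
    (c : nat -> pred bool) (j : nat) :
  (forall i, (i < j)%N -> measurable [set w | b i w]) ->
  measurable [set w | forall i, (i < j)%N -> c i (b i w)].
Proof.
move=> mb; rewrite (_ : [set w | _] =
    \bigcap_(i in `I_j) [set w | c i (b i w)]); last by apply/seteqP; split.
apply: fin_bigcap_measurable => // i /= ij.
rewrite (_ : [set w | _] = ([set w | b i w] `&` [set w | c i true]) `|`
    (~` [set w | b i w] `&` [set w | c i false])).
  have mcst (e : bool) : measurable [set w : T | e].
    by case: e => //; [rewrite (_ : [set _ | _] = setT)|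
      rewrite (_ : [set _ | _] = set0)] => //; apply/seteqP; split.
  apply: measurableU; apply: measurableI => //; first exact: mb.
  by apply: measurableC; exact: mb.
apply/seteqP; split => w /=.
  by case: (b i w) => cw; [left|right].
by move=> [[-> //]|[/negP/negbTE ->]].
Qed.

Lemma probability_setI_as d (T : measurableType d) (R : realType)
    (P : probability T R) (G F : set T) :
  measurable G -> measurable F -> P (~` G) = 0%E -> P (F `&` G) = P F.
Proof.
move=> mG mF PG; apply/esym; rewrite -[F in LHS](setUIDK F G) measureU//=.
- rewrite -[RHS]adde0; congr (_ + _)%E; apply: subset_measure0 PG => //.
  + exact: measurableD.
  + exact: measurableC.
- exact: measurableI.
- exact: measurableD.
- by apply/seteqP; split => w //= [[]] ? ? [].
Qed.

(** * Counting the changes that precede each access time *)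

Section change_process.
Context {d : measure_display} {T : measurableType d} {R : realType}.
Variables (P : probability T R) (Delta p : R).
Variables (S A : nat -> {RV P >-> R}).
Hypotheses (Delta_gt0 : 0 < Delta) (p_gt0 : 0 < p).
Hypotheses (expS : forall j, is_exponential Delta (S j)).
Hypotheses (expA : forall k, is_exponential p (A k)).

Let X (i : nat + nat) : {RV P >-> R} :=
  match i with inl j => S j | inr k => A k end.
Hypothesis indX : mutually_independent X.

Local Notation C n := (arrival (fun j => S j : T -> R) n).
Local Notation t k := (arrival (fun j => A j : T -> R) k).

(* Unbounded holding times are more than is needed to rule out explosion, but
   their almost sure occurrence follows at once from independence. *)
Definition regular : set T := [set w |
  [/\ forall j, 0 <= S j w, forall k, 0 <= A k w &
      forall M : nat, exists n, M%:R < S n w]].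

Lemma regular_measurable : measurable regular.
Proof.
rewrite (_ : regular = (\bigcap_j [set w | 0 <= S j w]) `&`
    (\bigcap_j [set w | 0 <= A j w]) `&`
    \bigcap_M \bigcup_n [set w | M%:R < S n w]).
  apply: measurableI; first apply: measurableI.
  - by apply: bigcapT_measurable => j; apply: measurable_set_ler.
  - by apply: bigcapT_measurable => j; apply: measurable_set_ler.
  - apply: bigcapT_measurable => M; apply: bigcupT_measurable => n.
    by apply: measurable_set_ltr.
apply/seteqP; split => w /=.
  move=> [S0 A0 Sy]; split; first by split => j _; [exact: S0|exact: A0].
  by move=> M _; have [n Mn] := Sy M; exists n => //.
move=> [[S0 A0] Sy]; split => [j|j|M]; [exact: (S0 j I)|exact: (A0 j I)|].
by have [n _ Mn] := Sy M I; exists n.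
Qed.

Lemma exponential_nonneg r (Y : {RV P >-> R}) :
  is_exponential r Y -> P (~` [set w | 0 <= Y w]) = 0%E.
Proof.
move=> eY; rewrite (_ : ~` _ = Y @^-1` `]-oo, 0[).
  by rewrite eY// exponential_prob_lt0.
by apply/seteqP; split => w /=; rewrite in_itv/= ltNge => /negP.
Qed.

Lemma exponential_le r (Y : {RV P >-> R}) (M : R) : 0 < r -> 0 <= M ->
  is_exponential r Y -> P (Y @^-1` `]-oo, M]) = (1 - expR (- r * M))%:E.
Proof.
move=> r0 M0 eY.
rewrite (_ : _ @^-1` _ = ~` (Y @^-1` `]M, +oo[)).
  rewrite probability_setC; last first.
    by rewrite -[X in measurable X]setTI; exact: measurable_funP.
  by rewrite [X in (_ - X)%E](eY _ (measurable_itv _)) exponential_prob_tail.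
by apply/seteqP; split => w /=; rewrite !in_itv/= andbT leNgt => /negP.
Qed.

(** By independence the first [n] holding times all stay below [M] with probability [q ^+ n], where
    [q < 1]. *)
Lemma all_le_negligible (M : nat) :
  P (\bigcap_n (S n @^-1` `]-oo, M%:R])) = 0%E.
Proof.
pose q := 1 - expR (- Delta * M%:R).
have q0 : 0 <= q.
  by rewrite subr_ge0 -expR0 ler_expR mulNr oppr_le0 mulr_ge0// ltW.
have q1 : q < 1 by rewrite ltrBlDr ltrDl expR_gt0.
have mS n : measurable (S n @^-1` `]-oo, M%:R]).
  by rewrite -[X in measurable X]setTI; exact: measurable_funP.
have mF : measurable (\bigcap_n (S n @^-1` `]-oo, M%:R])).
  exact: bigcapT_measurable.
have leq_n n : (P (\bigcap_n (S n @^-1` `]-oo, M%:R])) <= (q ^+ n)%:E)%E.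
  pose s : seq (nat + nat) := [seq inl i | i <- iota 0 n].
  have us : uniq s by rewrite map_inj_uniq ?iota_uniq// => x y [].
  have := @indX s (fun=> `]-oo, M%:R]%classic) us (fun=> measurable_itv _).
  rewrite big_map (eq_bigr (fun=> q%:E)); last first.
    move=> i _; exact: (exponential_le Delta_gt0 (ler0n _ _) (expS i)).
  move=> E.
  have -> : (q ^+ n)%:E = (\big[*%E/1%E]_(j <- iota 0 n) q%:E)%E.
    rewrite -[in LHS](size_iota 0 n).
    elim: (iota 0 n) => [|a l IH]; first by rewrite big_nil.
    by rewrite big_cons -IH /= exprS EFinM.
  rewrite -E; apply: le_measure; rewrite ?inE//.
    by apply: fin_bigcap_measurable => // i _;
      rewrite -[X in measurable X]setTI; exact: measurable_funP.
  move=> w Sw i /= /mapP[m _ ->]; exact: Sw.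
apply/eqP; rewrite eq_le measure_ge0 andbT.
have cq : ((q ^+ n)%:E @[n --> \oo] --> 0%E)%E.
  by apply: cvg_EFin; [exact: nearW|apply: cvg_expr; rewrite ger0_norm].
rewrite -(cvg_lim _ cq)//; apply: lime_ge; first by apply/cvg_ex; exists 0%E.
exact: nearW.
Qed.

Lemma regular_as : P (~` regular) = 0%E.
Proof.
have mS0 j : measurable [set w | 0 <= S j w] by apply: measurable_set_ler.
have mA0 j : measurable [set w | 0 <= A j w] by apply: measurable_set_ler.
apply/(negligibleP _ (measurableC regular_measurable)).
apply: (@negligibleS _ _ _ _ ((\bigcup_j ~` [set w | 0 <= S j w]) `|`
    (\bigcup_j ~` [set w | 0 <= A j w]) `|`
    \bigcup_M (\bigcap_n (S n @^-1` `]-oo, M%:R])))).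
  move=> w rw; apply: contrapT => nw; apply: rw; split => [j|j|M].
  - by apply: contrapT => Sj; apply: nw; left; left; exists j.
  - by apply: contrapT => Aj; apply: nw; left; right; exists j.
  - apply: contrapT => SM; apply: nw; right; exists M => // n _ /=.
    rewrite in_itv/= leNgt; apply/negP => Mn.
    by apply: SM; exists n.
apply: negligibleU; first apply: negligibleU.
- apply: negligible_bigcup => j; apply/negligibleP; first exact: measurableC.
  exact: exponential_nonneg (expS j).
- apply: negligible_bigcup => j; apply/negligibleP; first exact: measurableC.
  exact: exponential_nonneg (expA j).
- apply: negligible_bigcup => M; apply/negligibleP; last first.
    exact: all_le_negligible.
  apply: bigcapT_measurable => n.
  by rewrite -[X in measurable X]setTI; exact: measurable_funP.
Qed.

Lemma arrivalS (Y : nat -> T -> R) n w :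
  arrival Y n.+1 w = arrival Y n w + Y n w.
Proof. by rewrite /arrival big_ord_recr. Qed.

Lemma arrival_homo (Y : nat -> T -> R) w m n : (forall j, 0 <= Y j w) ->
  (m <= n)%N -> arrival Y m w <= arrival Y n w.
Proof.
move=> Y0; elim: n => [|n IH]; first by rewrite leqn0 => /eqP ->.
rewrite leq_eqVlt => /predU1P[->//|/IH mn].
by rewrite arrivalS (le_trans mn)// lerDl.
Qed.

(* [change_bit i] is the indicator I_(i+1). *)
Definition change_bit (i : nat) (w : T) : bool :=
  `[< exists n, t i w < C n.+1 w <= t i.+1 w >].

(* Only the first n changes are looked at, so that this is a function of
   S_0, ..., S_(n-1), A_0, ..., A_i. *)
Definition change_bit_before (n i : nat) (w : T) : bool :=
  `[< exists2 m, (m < n)%N & t i w < C m.+1 w <= t i.+1 w >].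

(** A change found in an interval that ends by t_j comes no later than t_j, so monotonicity of the
    arrivals places it among the first [n]. *)
Lemma change_bit_beforeE w n j i : regular w -> t j w < C n.+1 w ->
  (i < j)%N -> change_bit i w = change_bit_before n i w.
Proof.
move=> [S0 A0 _] tC ij; apply/asboolP/asboolP; last by move=> [m _ ?]; exists m.
move=> [m /andP[tm mt]]; exists m; last by rewrite tm.
rewrite ltnNge; apply/negP => nm; move: tC; rewrite ltNge => /negP; apply.
have := @arrival_homo (fun j => S j : T -> R) w n.+1 m.+1 S0 nm.
move=> /le_trans; apply; apply: (le_trans mt).
exact: (arrival_homo A0).
Qed.

Lemma change_bit_next w n j : regular w -> C n w <= t j w -> t j w < C n.+1 w ->
  ~~ change_bit j w = (t j.+1 w < C n.+1 w).
Proof.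
move=> [S0 A0 _] Ct tC; rewrite ltNge; congr negb.
apply/asboolP/idP => [[m /andP[tm mt]]|Ct1]; last by exists n; rewrite tC.
apply: le_trans mt; apply: (arrival_homo S0).
rewrite ltnS leqNgt; apply/negP => mn; move: tm; rewrite ltNge => /negP; apply.
apply: le_trans Ct; exact: (arrival_homo S0).
Qed.

(** One holding time longer than t_j already pushes an arrival past t_j. The least index of such an
    arrival is positive, because C_0 = 0, and its predecessor is the count. *)
Lemma count_exists w j : regular w -> exists n, C n w <= t j w < C n.+1 w.
Proof.
move=> [S0 A0 Sy].
have ex : exists n, t j w < C n w.
  have [n Sn] := Sy (Num.bound `|t j w|); exists n.+1.
  rewrite arrivalS; apply: (@lt_le_trans _ _ (S n w)).
    by apply: lt_trans Sn; rewrite (le_lt_trans (ler_norm _))// archi_boundP.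
  rewrite lerDr; apply: le_trans (arrival_homo S0 (leq0n n)).
  by rewrite /arrival big_ord0.
case: (ex_minnP ex) => -[|m] tm min_m.
  move: tm; rewrite /arrival big_ord0 ltNge => /negP[].
  by apply: sumr_ge0 => i _.
exists m; rewrite tm andbT leNgt; apply/negP => /min_m.
by rewrite ltnn.
Qed.

(** The space is arbitrary so that [T] may also carry the sigma-algebra of finitely many holding
    times. *)
Lemma arrival_measurable_fun d' (T' : measurableType d') (Y : nat -> T' -> R) n :
  (forall i, (i < n)%N -> measurable_fun setT (Y i)) ->
  measurable_fun setT (arrival Y n).
Proof.
elim: n => [|n IH] mY.
  rewrite (_ : arrival Y 0 = cst 0); first exact: measurable_cst.
  by apply/funext => w; rewrite /arrival big_ord0.
rewrite (_ : arrival Y n.+1 = (arrival Y n \+ Y n)).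
  apply: measurable_funD; last exact: mY.
  by apply: IH => i ni; apply: mY; exact: ltnW.
by apply/funext => w; rewrite /arrival big_ord_recr.
Qed.

(** The list [s] is left free because the race needs the past both alone and enlarged by the current
    holding time. *)
Lemma past_measurable s n j (c : nat -> pred bool) :
  (forall i, (i < n)%N -> inl i \in s) -> (forall i, (i < j)%N -> inr i \in s) ->
  <<s cylinders X s >> ([set w | forall i, (i < j)%N -> c i (change_bit_before n i w)]
    `&` [set w | C n w <= t j w]).
Proof.
move=> nS jS; pose T' := g_sigma_algebraType (cylinders X s).
have mC m : (m <= n)%N -> measurable_fun [set: T'] (C m : T' -> R).
  move=> mn; apply: (@arrival_measurable_fun _ T') => i im.
  apply: (@cylinders_measurable_fun _ _ _ _ _ X s (inl i)).
  exact/nS/(leq_trans im).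
have mt k : (k <= j)%N -> measurable_fun [set: T'] (t k : T' -> R).
  move=> kj; apply: (@arrival_measurable_fun _ T') => i ik.
  apply: (@cylinders_measurable_fun _ _ _ _ _ X s (inr i)).
  exact/jS/(leq_trans ik).
apply: (@measurableI _ T'); last first.
  by apply: (@measurable_set_ler _ T'); [exact: mC|exact: mt].
apply: (@measurable_bits _ T') => i ij.
rewrite (_ : [set w | _] = \bigcup_(m in `I_n)
    ([set w : T' | t i w < C m.+1 w] `&` [set w | C m.+1 w <= t i.+1 w])).
  apply: bigcup_measurable => m /= mn; apply: measurableI.
    apply: (@measurable_set_ltr _ T'); [|exact: mC].
    by apply: mt; exact: ltnW.
  by apply: (@measurable_set_ler _ T'); [exact: mC|exact: mt].
apply/seteqP; split => w /=.
  by move=> /asboolP[m mn /andP[? ?]]; exists m.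
by move=> [m mn [tm mt']]; apply/asboolP; exists m => //; rewrite tm.
Qed.

Lemma change_bit_measurable i : measurable [set w | change_bit i w].
Proof.
rewrite (_ : [set w | _] = \bigcup_m
    ([set w | t i w < C m.+1 w] `&` [set w | C m.+1 w <= t i.+1 w])).
  apply: bigcup_measurable => m _; apply: measurableI.
    by apply: measurable_set_ltr; apply: arrival_measurable_fun.
  by apply: measurable_set_ler; apply: arrival_measurable_fun.
apply/seteqP; split => w /=.
  by move=> /asboolP[m /andP[? ?]]; exists m.
by move=> [m _ [tm mt]]; apply/asboolP; exists m => //; rewrite tm.
Qed.

(* Given that exactly n changes occurred before t_j, the interval (t_j, t_(j+1)]
   is free of changes iff the residual holding time outlasts A_j. *)
Lemma no_change_race n j (c : nat -> pred bool) :
  let E := [set w | forall i, (i < j)%N -> c i (change_bit_before n i w)]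
    `&` [set w | C n w <= t j w] in
  P (E `&` [set w | t j w < C n.+1 w] `&` [set w | t j.+1 w < C n.+1 w]) =
  ((p / (p + Delta))%:E * P (E `&` [set w | (t j w < C n.+1 w)%R]))%E.
Proof.
move=> E.
pose past := [seq inl i | i <- iota 0 n] ++ [seq inr i | i <- iota 0 j].
(* [U] is the age at t_j of the current holding time [S n]: the next change comes after t_j iff
   [S n] outlasts [U], and after t_(j+1) iff it outlasts [U + A j]. *)
pose U w := t j w - C n w.
have mem_past (i : nat + nat) :
    (i \in past) = match i with inl m => (m < n)%N | inr k => (k < j)%N end.
  rewrite mem_cat; case: i => [m|k].
    rewrite mem_map; last by move=> ? ? [].
    rewrite mem_iota add0n/=; apply/orP/idP => [[//|/mapP[? _ //]]|]; by left.
  rewrite orbC mem_map; last by move=> ? ? [].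
  rewrite mem_iota add0n/=; apply/orP/idP => [[//|/mapP[? _ //]]|]; by left.
have upast : uniq past.
  rewrite cat_uniq !map_inj_uniq ?iota_uniq//=; last 2 first.
  - by move=> ? ? [].
  - by move=> ? ? [].
  by rewrite andbT; apply/hasPn => _ /mapP[k _ ->]; apply/negP => /mapP[].
have UE x : [set w | t j w + x w < C n.+1 w] = [set w | U w + x w < S n w].
  by apply/seteqP; split => w /=; rewrite arrivalS /U; lra.
have sE s : {subset past <= s} -> <<s cylinders X s >> E.
  by move=> ps; apply: past_measurable => i ni; apply: ps; rewrite mem_past.
have mU s : {subset past <= s} ->
    measurable_fun setT (U : g_sigma_algebraType (cylinders X s) -> R).
  move=> ps; apply: measurable_funB.
    apply: (@arrival_measurable_fun _ (g_sigma_algebraType (cylinders X s))) => i ij.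
    apply: (@cylinders_measurable_fun _ _ _ _ _ X s (inr i)).
    by apply: ps; rewrite mem_past.
  apply: (@arrival_measurable_fun _ (g_sigma_algebraType (cylinders X s))) => i ij.
  apply: (@cylinders_measurable_fun _ _ _ _ _ X s (inl i)).
  by apply: ps; rewrite mem_past.
have sub_id : {subset past <= past} by [].
have sub_cons : {subset past <= inl n :: past}.
  by move=> i ip; rewrite inE ip orbT.
pose T1 := g_sigma_algebraType (cylinders X past).
pose T2 := g_sigma_algebraType (cylinders X (inl n :: past)).
have mSn : measurable_fun setT (S n : T2 -> R).
  apply: (@cylinders_measurable_fun _ _ _ _ _ X (inl n :: past) (inl n)).
  by rewrite inE eqxx.
have E0 : [set w | t j w < C n.+1 w] = [set w | U w < S n w].
  by apply/seteqP; split => w /=; rewrite arrivalS /U; lra.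
have E1 : [set w | t j.+1 w < C n.+1 w] = [set w | U w + A j w < S n w].
  by apply/seteqP; split => w /=; rewrite !arrivalS /U; lra.
rewrite E0 E1; apply: memoryless_race => //.
- exact: cylinders_measurable (sE _ sub_id).
- by apply: measurable_funB; apply: arrival_measurable_fun.
- by move=> w [_ /=]; rewrite subr_ge0.
(* First independence: [S n] does not occur among the variables that determine [E] and [U]. *)
- move=> B1 B2 mB1 mB2; rewrite setIA.
  apply: (@independent_sigma _ _ _ P _ X indX past (inl n)) => //.
  + by rewrite mem_past ltnn.
  + apply: (@measurableI _ T1); first exact: sE sub_id.
    by rewrite -[X in measurable X]setTI; exact: (mU _ sub_id).
(* Second independence: [A j] is fresh even after [S n] has joined the past, so it is independent of
   the residual [S n - U]. *)
- move=> B1 B2 mB1 mB2; rewrite setIA -setIA [in RHS]muleC.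
  rewrite [X in P (_ `&` X)]setIC setIA.
  apply: (@independent_sigma _ _ _ P _ X indX (inl n :: past) (inr j)) => //.
  + by rewrite inE mem_past ltnn.
  + by rewrite /= mem_past ltnn.
  + apply: (@measurableI _ T2).
      apply: (@measurableI _ T2); first exact: sE sub_cons.
      by apply: (@measurable_set_ltr _ T2) => //; exact: mU sub_cons.
    rewrite -[X in measurable X]setTI.
    by apply: (@measurable_funB _ T2) => //; exact: mU sub_cons.
Qed.

(** Split according to the number of changes up to t_j. On each piece the earlier indicators depend
    on finitely many variables and [no_change_race] applies; its factor is the same for all pieces,
    so it comes out of the sum. *)
Lemma no_change_prob j (c : nat -> pred bool) :
  let E := [set w | forall i, (i < j)%N -> c i (change_bit i w)] in
  P (E `&` [set w | ~~ change_bit j w]) = ((p / (p + Delta))%:E * P E)%E.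
Proof.
move=> E.
have mE : measurable E by apply: measurable_bits => i _; exact: change_bit_measurable.
have mB : measurable [set w | ~~ change_bit j w].
  rewrite (_ : [set w | _] = ~` [set w | change_bit j w]).
    by apply: measurableC; exact: change_bit_measurable.
  by apply/seteqP; split => w /= /negP.
pose N n := regular `&` ([set w | C n w <= t j w] `&` [set w | t j w < C n.+1 w]).
have mC n : measurable_fun setT (C n) by apply: arrival_measurable_fun.
have mt k : measurable_fun setT (t k) by apply: arrival_measurable_fun.
have mN n : measurable (N n).
  apply: measurableI; first exact: regular_measurable.
  by apply: measurableI; [exact: measurable_set_ler|exact: measurable_set_ltr].
have tN : trivIset setT N.
  apply/trivIsetP => m n _ _; wlog mn : m n / (m < n)%N => [H|_].
    by rewrite neq_ltn => /orP[mn|nm]; [|rewrite setIC]; apply: H => //;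
      rewrite ?(ltn_eqF mn) ?(ltn_eqF nm).
  apply/seteqP; split => // w [[[S0 _ _] [_ tC]] [_ [Ct _]]].
  move: tC; rewrite /= ltNge => /negP; apply; apply: le_trans Ct.
  exact: (arrival_homo S0).
have UN : \bigcup_n N n = regular.
  apply/seteqP; split => [w [n _ []//]|w rw].
  by have [n /andP[Ct tC]] := count_exists j rw; exists n.
(* The pieces cover only [regular], which has full probability. *)
have sumN F : measurable F -> P F = (\sum_(0 <= n <oo) P (F `&` N n))%E.
  move=> mF; rewrite -(probability_setI_as regular_measurable mF regular_as).
  rewrite -UN setI_bigcupr measure_bigcup//=; last 2 first.
  - by move=> n _; exact: measurableI.
  - exact: trivIset_setIl.
  by apply: eq_eseriesl => n; rewrite in_setT.
rewrite (sumN _ mE) (sumN _ (measurableI _ _ mE mB)) -nneseriesZl//.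
apply: eq_eseriesr => n _.
pose E' := [set w | forall i, (i < j)%N -> c i (change_bit_before n i w)]
    `&` [set w | C n w <= t j w].
have mE' : measurable E'.
  apply: (@cylinders_measurable _ _ _ _ _ X
    ([seq inl i | i <- iota 0 n] ++ [seq inr i | i <- iota 0 j])).
  apply: past_measurable => i ij; rewrite mem_cat; apply/orP.
    by left; apply/mapP; exists i; rewrite // mem_iota.
  by right; apply/mapP; exists i; rewrite // mem_iota.
have EN : E `&` N n = E' `&` [set w | t j w < C n.+1 w] `&` regular.
  apply/seteqP; split => w /=.
    move=> [Ew [rw [Ct tC]]]; split => //; split => //; split => // i ij.
    by rewrite -(change_bit_beforeE rw tC ij) Ew.
  move=> [[[Ew Ct] tC] rw]; split => // i ij.
  by rewrite (change_bit_beforeE rw tC ij) Ew.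
have EBN : E `&` [set w | ~~ change_bit j w] `&` N n =
    E' `&` [set w | t j w < C n.+1 w] `&` [set w | t j.+1 w < C n.+1 w]
    `&` regular.
  rewrite setIAC EN; apply/seteqP; split => w /=.
    move=> [[[Ew tC] rw]]; rewrite (change_bit_next rw Ew.2 tC) => ?.
    by split.
  move=> [[[Ew tC] tC1] rw]; split; first by split.
  by rewrite (change_bit_next rw Ew.2 tC).
have m1 : measurable (E' `&` [set w | t j w < C n.+1 w]).
  by apply: measurableI => //; exact: measurable_set_ltr.
have m2 : measurable (E' `&` [set w | t j w < C n.+1 w]
    `&` [set w | t j.+1 w < C n.+1 w]).
  by apply: measurableI => //; exact: measurable_set_ltr.
rewrite EN EBN !(probability_setI_as regular_measurable _ regular_as)//.
exact: no_change_race.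
Qed.

End change_process.

(** * Pathwise convergence of the perturbed linear recursion *)

Section step_contraction.
Variable R : realType.
Implicit Types (V beta gamma x u y r s N xi : nat -> R).

Lemma nneseries_unbounded beta (n0 : nat) (M : R) :
  (forall k, 0 <= beta k) -> (\sum_(0 <= k <oo) (beta k)%:E = +oo)%E ->
  exists m, M < \sum_(n0 <= k < n0 + m) beta k.
Proof.
move=> b0 boo.
apply: contrapT => nM.
have leM m : \sum_(n0 <= k < n0 + m) beta k <= M.
  by rewrite leNgt; apply/negP => Mm; apply: nM; exists m.
suff : (\sum_(0 <= k <oo) (beta k)%:E <=
    (\sum_(0 <= k < n0) beta k + M)%:E)%E by rewrite boo.
apply: lime_le; first by apply: is_cvg_nneseries => k _ _; rewrite lee_fin.
exists n0 => // m /= n0m; rewrite sumEFin lee_fin.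
by rewrite (@big_cat_nat _ _ _ n0)//= lerD2l -{1}(subnKC n0m).
Qed.

(** Once at most [delta], [V] stays there; and it cannot remain above forever, since the decrements
    [c * beta k] have an infinite sum while [V] is nonnegative. *)
Lemma eventual_descent_cvg0 V beta :
  (forall k, 0 <= V k) -> (forall k, 0 <= beta k) ->
  (\sum_(0 <= k <oo) (beta k)%:E = +oo)%E ->
  (forall delta, 0 < delta -> exists2 c, 0 < c &
     \forall k \near \oo, V k.+1 <= Num.max delta (V k - c * beta k)) ->
  V @ \oo --> (0 : R).
Proof.
move=> V0 b0 boo H; apply/cvgrPdist_le => delta d0.
have [c c0 [n0 _ Hc]] := H _ d0.
have stay k m : (n0 <= k)%N -> V k <= delta -> V (k + m)%N <= delta.
  move=> nk1 Vk; elim: m => [|m IH]; first by rewrite addn0.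
  rewrite addnS (le_trans (Hc _ _))//=; first exact: leq_trans nk1 (leq_addr _ _).
  by rewrite ge_max lexx/= lerBlDr (le_trans IH)// lerDl mulr_ge0// ltW.
have [k1 nk1 Vk1] : exists2 k, (n0 <= k)%N & V k <= delta; last first.
  exists k1 => // m /= km; rewrite sub0r normrN ger0_norm//.
  by rewrite -(subnKC km) stay.
apply: contrapT => nV.
have Vgt k : (n0 <= k)%N -> delta < V k.
  by move=> nk; rewrite ltNge; apply/negP => ?; apply: nV; exists k.
have dec m : V (n0 + m)%N <= V n0 - c * \sum_(n0 <= k < n0 + m) beta k.
  elim: m => [|m IH]; first by rewrite addn0 big_geq// mulr0 subr0.
  rewrite addnS big_nat_recr/= ?leq_addr// mulrDr opprD addrA.
  have := Hc (n0 + m)%N (leq_addr _ _).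
  rewrite le_max => /orP[|/le_trans]; last by apply; rewrite lerD2r.
  by rewrite leNgt -addnS Vgt// leq_addr.
(* A partial sum beyond [V n0 / c] would make [V] negative. *)
have [m Mm] := nneseries_unbounded n0 (V n0 / c) b0 boo.
have := dec m; rewrite leNgt => /negP; apply.
rewrite ltr_pdivrMr// in Mm.
rewrite (lt_le_trans _ (V0 _))// subr_lt0 mulrC.
exact: Mm.
Qed.

End step_contraction.

(** * One-step estimates for the perturbed linear system *)

Section pointwise_steps.
Variable R : realFieldType.

(** All quantities grow at most linearly in [L], and each error term carries one of the small
    factors [ga], [Nk], [N']. Here [C] bounds [x + c], [K1] bounds the increment of [y] divided by
    [ga], and [K] adds up the contributions. *)
Lemma perturbation_bound (a om c ga be xi Nk N' x u eps : R) :
  let C := `|c| + 1 in let K1 := a + om * (1 + C) + C in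
  let K := 1 + K1 + C + om * C in
  let y := u - Nk * (x + c) in
  let y' := y + ga * (- a * x - om * y + xi * (x + c)) in
  let L := 1 + `|x| + `|u| in
  0 < a -> 0 < om -> 0 < be -> be <= ga -> 0 <= eps -> eps <= 1 ->
  `|xi| <= 1 -> ga <= eps -> `|Nk| <= eps -> `|N'| <= eps ->
  `|y' - u| <= eps * K * L /\
  `|om * Nk * (x + c) + N' * (be / ga) * y'| <= eps * K * L.
Proof.
move=> C K1 K y y' L a0 om0 be0 bega e0 e1 xi1 gae Nke N'e.
have ga0 : 0 < ga by exact: lt_le_trans be0 bega.
have C1 : 1 <= C by rewrite /C lerDr.
have L1 : 1 <= L by rewrite /L -addrA lerDl addr_ge0.
have L0 : 0 <= L by exact: le_trans L1.
have xL : `|x| <= L by rewrite /L -addrA addrCA lerDl addr_ge0// ler01.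
have uL : `|u| <= L by rewrite /L lerDr addr_ge0// ler01.
have xc : `|x + c| <= C * L.
  rewrite (le_trans (ler_normD _ _))// /C mulrDl mul1r addrC lerD//.
  by rewrite ler_peMr.
have Nxc : `|Nk * (x + c)| <= eps * (C * L) by rewrite normrM ler_pM.
have CL0 : 0 <= C * L by rewrite mulr_ge0// (le_trans ler01).
have yL : `|y| <= (1 + C) * L.
  rewrite (le_trans (ler_normB _ _))// mulrDl mul1r lerD//.
  by rewrite (le_trans Nxc)// ler_piMl.
have K10 : 0 <= K1.
  have : 0 <= om * (1 + C) by rewrite mulr_ge0 ?(ltW om0)//; lra.
  by rewrite /K1; lra.
have incr : `|ga * (- a * x - om * y + xi * (x + c))| <= eps * (K1 * L).
  rewrite normrM (gtr0_norm ga0) ler_pM ?(ltW ga0)//.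
  rewrite (le_trans (ler_normD _ _))// /K1 2!mulrDl.
  apply: lerD; last by rewrite normrM -[leRHS]mul1r ler_pM.
  rewrite (le_trans (ler_normB _ _))// lerD//.
    by rewrite normrM normrN (gtr0_norm a0) ler_wpM2l// ltW.
  by rewrite normrM (gtr0_norm om0) -mulrA ler_wpM2l// ltW.
have sL : `|y' - u| <= eps * ((K1 + C) * L).
  have -> : y' - u = ga * (- a * x - om * y + xi * (x + c)) - Nk * (x + c).
    have : y + Nk * (x + c) = u by rewrite /y subrK.
    by rewrite /y'; clearbody y => <-; ring.
  by rewrite (le_trans (ler_normB _ _))// mulrDl mulrDr lerD.
have omC0 : 0 <= om * C by rewrite mulr_ge0 ?(ltW om0)//; lra.
split.
  rewrite (le_trans sL)// -mulrA ler_wpM2l// ler_wpM2r// /K; lra.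
have y'L : `|y'| <= (1 + K1 + C) * L.
  rewrite -(subrK u y') (le_trans (ler_normD _ _))//.
  have : eps * ((K1 + C) * L) <= (K1 + C) * L.
    by rewrite ler_piMl// mulr_ge0//; lra.
  by move: sL uL; lra.
have -> : eps * K * L = om * (eps * (C * L)) + eps * ((1 + K1 + C) * L).
  by rewrite /K; ring.
rewrite (le_trans (ler_normD _ _))// lerD//.
  by rewrite -mulrA normrM (gtr0_norm om0) ler_wpM2l// ltW.
have bg0 : 0 <= be / ga by rewrite divr_ge0// ltW.
rewrite normrM ler_pM// normrM (ger0_norm bg0) -[leRHS]mulr1 ler_pM//.
by rewrite ler_pdivrMr// mul1r.
Qed.

(** Up to errors, [x] drifts by [be * (w - b * x)] and [w] by [- ga * om * w]. The weight [4 / b]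
    makes [w] too small to offset the pull of [- b * x], and [be <= eta * ga] makes the motion of
    [x] negligible on the scale of [w]. *)
Lemma two_timescale_step (b om D delta eps eta be ga x w r s : R) :
  let M := Num.max (Num.max `|x| (4 / b * `|w|)) delta in
  let u := w - b * x in
  0 < b -> 0 < om -> 0 < delta -> D = 1 / delta + 1 + b / 4 + b ->
  0 <= eps -> eps <= 1 -> eps * D <= b / 4 -> 16 * eps * D <= b * om ->
  0 < be -> be <= ga -> be <= eta * ga -> 32 * eta * D <= om ->
  ga * om <= 1 -> be * b <= 1 ->
  `|r| <= eps * (1 + `|x| + `|u|) -> `|s| <= eps * (1 + `|x| + `|u|) ->
  `|x + be * (u + s)| <= M - be * (b / 2 * delta) /\
  4 / b * `|w - ga * om * w + ga * r + b * be * (u + s)| <=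
    M - be * (om / 2 * delta).
Proof.
move=> M u b0 om0 d0 DE e0 e1 eD eDo be0 bega beta_eta etaD gaom beb rL sL.
have xM : `|x| <= M by rewrite /M !le_max lexx.
have wM : `|w| <= b / 4 * M.
  have : 4 / b * `|w| <= M by rewrite /M !le_max lexx orbT.
  by rewrite -ler_pdivlMl ?divr_gt0// invf_div.
have dM : delta <= M by rewrite /M le_max lexx orbT.
have M0 : 0 < M by exact: lt_le_trans dM.
have ga0 : 0 < ga by exact: lt_le_trans bega.
have uM : `|u| <= b / 4 * M + b * M.
  rewrite (le_trans (ler_normB _ _))// lerD// normrM (gtr0_norm b0).
  by rewrite ler_wpM2l// ltW.
have oneM : 1 <= 1 / delta * M by rewrite mul1r ler_pdivlMl// mulr1.
(* The constant 1 is absorbed by [1 / delta * M], as [M] is at least [delta]; this is why [M]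
   includes [delta]. *)
have LM : 1 + `|x| + `|u| <= D * M.
  by rewrite DE !mulrDl mul1r in oneM *; lra.
have uD : `|u| <= D * M by apply: le_trans LM; rewrite lerDr addr_ge0.
have D0 : 0 < D.
  by rewrite DE; have := divr_gt0 ltr01 d0; lra.
have DM0 : 0 < D * M by rewrite mulr_gt0.
have rM : `|r| <= eps * (D * M) by apply: (le_trans rL); rewrite ler_wpM2l.
have sM : `|s| <= eps * (D * M) by apply: (le_trans sL); rewrite ler_wpM2l.
split.
  have -> : x + be * (u + s) = (1 - be * b) * x + be * w + be * s.
    by rewrite /u; ring.
  (* The contraction gains [b], while [w] and [s] cost [b / 4] each; [b / 2] is left. *)
  have h1 : `|(1 - be * b) * x| <= (1 - be * b) * M.
    by rewrite normrM ger0_norm ?subr_ge0// ler_wpM2l// subr_ge0.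
  have h2 : `|be * w| <= be * (b / 4 * M).
    by rewrite normrM gtr0_norm// ler_wpM2l// ltW.
  have h3 : `|be * s| <= be * (b / 4 * M).
    rewrite normrM gtr0_norm// ler_wpM2l ?(ltW be0)// (le_trans sM)// mulrA.
    by rewrite ler_wpM2r// ltW.
  have h4 : be * (b / 2 * delta) <= be * (b / 2 * M).
    by rewrite !ler_wpM2l ?divr_ge0// ltW.
  by rewrite (le_trans (ler_normD _ _))//
    (le_trans (lerD (ler_normD _ _) (lexx _)))//; lra.
rewrite -ler_pdivlMl ?divr_gt0// invf_div.
(* The contraction gains [b * om / 4] and the two errors cost [b * om / 16] each; the remaining
   [b * om / 8] is [om / 2] after rescaling by [4 / b]. *)
have h1 : `|w - ga * om * w| <= (1 - ga * om) * (b / 4 * M).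
  rewrite -{1}(mul1r w) -mulrBl normrM ger0_norm ?subr_ge0//.
  by rewrite ler_wpM2l// subr_ge0.
have h2 : `|ga * r| <= ga * (b * om / 16 * M).
  rewrite normrM gtr0_norm// ler_wpM2l ?(ltW ga0)// (le_trans rM)// mulrA.
  by rewrite ler_wpM2r ?(ltW M0)//; lra.
have h3 : `|b * be * (u + s)| <= ga * (b * om / 16 * M).
  have us : `|u + s| <= 2 * (D * M).
    rewrite (le_trans (ler_normD _ _))//.
    have : eps * (D * M) <= D * M by rewrite ler_piMl// ltW.
    lra.
  rewrite normrM gtr0_norm ?mulr_gt0//.
  apply: (@le_trans _ _ (b * (eta * ga) * (2 * (D * M)))).
    by apply: ler_pM; rewrite ?ler_wpM2l// ?mulr_ge0// ltW.
  have -> : b * (eta * ga) * (2 * (D * M)) = ga * ((32 * eta * D) * (b / 16 * M)).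
    by field.
  have -> : ga * (b * om / 16 * M) = ga * (om * (b / 16 * M)) by ring.
  by rewrite ler_wpM2l ?(ltW ga0)// ler_wpM2r// mulr_ge0// ?divr_ge0// ltW.
have h4 : be * (om / 2 * delta) <= ga * (om / 2 * M).
  apply: ler_pM; rewrite ?(ltW be0)//; first by rewrite mulr_ge0 ?divr_ge0// ltW.
  by rewrite ler_wpM2l ?divr_ge0// ltW.
have -> : b / 4 * (M - be * (om / 2 * delta)) =
  b / 4 * M - b / 4 * (be * (om / 2 * delta)) by ring.
have h5 : b / 4 * (be * (om / 2 * delta)) <= b / 4 * (ga * (om / 2 * M)).
  by rewrite ler_wpM2l// divr_ge0// ltW.
rewrite (le_trans (ler_normD _ _))//
    (le_trans (lerD (ler_normD _ _) (lexx _)))//.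
lra.
Qed.

(** Along x' = u, u' = - a x - om u the cross terms in the derivative of [Q] cancel, leaving - om
    (u^2 + a x^2). [C1] bounds the first-order effect of [r] and [s], and [C2] the second-order
    terms of the step. *)
Lemma one_timescale_step (a om eps be x u r s : R) :
  let Q x u := a * x ^+ 2 + u ^+ 2 / 2 + (u + om * x) ^+ 2 / 2 in
  let C1 := 2 * a + 1 + (1 + om) ^+ 2 in
  let C2 := 4 * a + (a + om + 1) ^+ 2 in
  let m := x ^+ 2 + u ^+ 2 in
  0 < a -> 0 < om -> 0 <= eps -> eps <= 1 -> 0 < be ->
  `|r| <= eps * (1 + `|x| + `|u|) -> `|s| <= eps * (1 + `|x| + `|u|) ->
  Q (x + be * (u + s)) (u + be * (- a * x - om * u + r)) <=
    Q x u - be * (om * (u ^+ 2 + a * x ^+ 2)) +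
    be * (3 * C1 * eps + 3 * C2 * be) * (1 + m).
Proof.
move=> Q C1 C2 m a0 om0 e0 e1 be0 rL sL.
set L := 1 + `|x| + `|u| in rL sL.
have x0 := normr_ge0 x; have u0 := normr_ge0 u.
have L0 : 0 <= L by rewrite /L; lra.
have L2 : L ^+ 2 <= 3 * (1 + m).
  rewrite /L /m -(real_normK (num_real x)) -(real_normK (num_real u)).
  have := sqr_ge0 (1 - `|x|); have := sqr_ge0 (1 - `|u|).
  have := sqr_ge0 (`|x| - `|u|); rewrite !expr2; lra.
have xL : `|x| <= L by rewrite /L; lra.
have uL : `|u| <= L by rewrite /L; lra.
have eL : eps * L <= L by rewrite ler_piMl.
(* [Q] is quadratic, so its expansion in [be] is exact: the dissipation, the first-order errors, and
   a remainder in the square of [be]. *)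
have -> : Q (x + be * (u + s)) (u + be * (- a * x - om * u + r)) =
  Q x u - be * (om * (u ^+ 2 + a * x ^+ 2)) +
  be * ((2 * a * (x * s) + u * r + (u + om * x) * (r + om * s)) +
        be * (a * (u + s) ^+ 2 + (- a * x - om * u + r) ^+ 2 / 2
        + (- a * x + r + om * s) ^+ 2 / 2)).
  by rewrite /Q; field.
rewrite lerD2l -[leRHS]mulrA ler_wpM2l ?(ltW be0)// [leRHS]mulrDl.
have sq z A : 0 <= A -> `|z| <= A * L -> z ^+ 2 <= A ^+ 2 * L ^+ 2.
  move=> A0 zA; rewrite -(real_normK (num_real z)) -exprMn.
  by rewrite lerXn2r ?nnegrE// mulr_ge0.
have prd z z' A B : 0 <= A -> 0 <= B -> `|z| <= A * L -> `|z'| <= B * (eps * L) ->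
    z * z' <= A * B * eps * L ^+ 2.
  move=> A0 B0 zA zB; rewrite (le_trans (ler_norm _))// normrM.
  rewrite (_ : A * B * eps * L ^+ 2 = A * L * (B * (eps * L))); last by ring.
  by rewrite ler_pM.
have eL0 : 0 <= eps * L by rewrite mulr_ge0.
have aL0 : 0 <= a * L by rewrite mulr_ge0// ltW.
have oL0 : 0 <= om * L by rewrite mulr_ge0// ltW.
have ax : `|- a * x| <= a * L.
  by rewrite normrM normrN (gtr0_norm a0) ler_wpM2l// ltW.
have ox z : `|om * z| = om * `|z| by rewrite normrM (gtr0_norm om0).
have oxL : om * `|x| <= om * L by rewrite ler_wpM2l// ltW.
have ouL : om * `|u| <= om * L by rewrite ler_wpM2l// ltW.
have osL : om * `|s| <= om * (eps * L) by rewrite ler_wpM2l// ltW.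
have oeL : om * (eps * L) <= om * L by rewrite ler_wpM2l// ltW.
apply: lerD.
  have p1 := @prd x s 1 1 ler01 ler01; rewrite !mul1r in p1.
  have {}p1 := p1 xL sL.
  have p2 := @prd u r 1 1 ler01 ler01; rewrite !mul1r in p2.
  have {}p2 := p2 uL rL.
  have o1 : 0 <= 1 + om by lra.
  have p3 : (u + om * x) * (r + om * s) <= (1 + om) * (1 + om) * eps * L ^+ 2.
    apply: prd => //.
      by rewrite (le_trans (ler_normD _ _))// ox mulrDl mul1r lerD.
    by rewrite (le_trans (ler_normD _ _))// ox mulrDl mul1r lerD.
  have p1a : 2 * a * (x * s) <= 2 * a * (eps * L ^+ 2).
    by rewrite ler_wpM2l// mulr_ge0// ltW.
  have C10 : 0 <= C1 * eps.
    by rewrite mulr_ge0// /C1; have := sqr_ge0 (1 + om); lra.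
  by move: (ler_wpM2l C10 L2) p1a p2 p3; rewrite /C1; clearbody L m; lra.
have -> : 3 * C2 * be * (1 + m) = be * (C2 * (3 * (1 + m))) by ring.
rewrite ler_wpM2l ?(ltW be0)//.
have C20 : 0 <= C2 by rewrite /C2; have := sqr_ge0 (a + om + 1); lra.
apply: (le_trans _ (ler_wpM2l C20 L2)).
have q1 : (u + s) ^+ 2 <= 2 ^+ 2 * L ^+ 2.
  by apply: sq => //; rewrite (le_trans (ler_normD _ _))//; lra.
have q2 : (- a * x - om * u + r) ^+ 2 <= (a + om + 1) ^+ 2 * L ^+ 2.
  apply: sq; first lra.
  have := ler_normD (- a * x - om * u) r; have := ler_normB (- a * x) (om * u).
  by rewrite ox; lra.
have q3 : (- a * x + r + om * s) ^+ 2 <= (a + om + 1) ^+ 2 * L ^+ 2.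
  apply: sq; first lra.
  have := ler_normD (- a * x + r) (om * s); have := ler_normD (- a * x) r.
  by rewrite ox; lra.
have q1a : a * (u + s) ^+ 2 <= a * (2 ^+ 2 * L ^+ 2) by rewrite ler_wpM2l// ltW.
rewrite /C2; move: q1a q2 q3.
set z := (a + om + 1) ^+ 2 * L ^+ 2; rewrite mulrDl -/z.
lra.
Qed.

End pointwise_steps.

Lemma cvg0_near_le (R : realType) (f : nat -> R) (e : R) :
  f @ \oo --> (0 : R) -> 0 < e -> \forall k \near \oo, `|f k| <= e.
Proof.
move=> /cvgrPdist_le cf e0; have := cf _ e0.
by apply: filterS => k; rewrite sub0r normrN.
Qed.

(** * Lyapunov convergence of the recursion in both regimes *)

Section recursion.
Variables (R : realType) (a om c : R) (beta gamma xi x y : nat -> R).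
Hypotheses (a_gt0 : 0 < a) (om_gt0 : 0 < om).
Hypotheses (beta_gt0 : forall k, 0 < beta k).
Hypothesis beta_sum : (\sum_(0 <= k <oo) (beta k)%:E = +oo)%E.
Hypothesis gamma_cvg0 : gamma @ \oo --> (0 : R).
Hypothesis beta_le_gamma : \forall k \near \oo, beta k <= gamma k.
Hypothesis xi_le1 : forall k, `|xi k| <= 1.
Hypothesis noise_cvg : cvgn (series (fun k => gamma k * xi k)).
Hypothesis yS : forall k,
  y k.+1 = y k + gamma k * (- a * x k - om * y k + xi k * (x k + c)).
Hypothesis xS : forall k, x k.+1 = x k + beta k * y k.+1.

Let N k := limn (series (fun k => gamma k * xi k)) -
  series (fun k => gamma k * xi k) k.
(* Adding the noise still to come turns the multiplicative noise into a
   perturbation of size o(gamma). *)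
Let u k := y k + N k * (x k + c).
Let s k := y k.+1 - u k.
Let r k := om * N k * (x k + c) + N k.+1 * (beta k / gamma k) * y k.+1.

Let NS k : N k = N k.+1 + gamma k * xi k.
Proof.
have h (g : nat -> R) : series g k.+1 = series g k + g k.
  by rewrite /series/= big_nat_recr.
by rewrite /N h opprD addrA subrK.
Qed.

Let N_cvg0 : N @ \oo --> (0 : R).
Proof.
rewrite -[0 in X in _ --> X](subrr (limn (series (fun k => gamma k * xi k)))).
by apply: cvgB; [exact: cvg_cst|exact: noise_cvg].
Qed.

Let xSE k : x k.+1 = x k + beta k * (u k + s k).
Proof. by rewrite xS; congr (_ + _ * _); rewrite /s addrC subrK. Qed.

(** The drop of [N] from [k] to [k.+1] cancels the noise term exactly. What remains is [N k.+1]
    times the increment of [x], together with the effect of replacing [y] by [u] in the damping;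
    these are the two terms of [r]. *)
Let uS k : beta k <= gamma k ->
  u k.+1 = u k + gamma k * (- a * x k - om * u k + r k).
Proof.
move=> bg; have g0 : gamma k != 0 by rewrite gt_eqF// (lt_le_trans (beta_gt0 k)).
have -> : gamma k * (- a * x k - om * u k + r k) =
    gamma k * (- a * x k - om * y k) + N k.+1 * (beta k * y k.+1).
  by rewrite /r /u; field.
by rewrite /u xS (NS k); move: (yS k); lra.
Qed.

Let small eps : 0 < eps -> \forall k \near \oo,
  [/\ beta k <= gamma k, gamma k <= eps,
      `|s k| <= eps * (1 + `|x k| + `|u k|) &
      `|r k| <= eps * (1 + `|x k| + `|u k|)].
Proof.
move=> e0.
pose C := `|c| + 1; pose K1 := a + om * (1 + C) + C.
pose K := 1 + K1 + C + om * C.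
have C1 : 1 <= C by rewrite /C lerDr.
have K1' : 1 <= K.
  have := mulr_ge0 (ltW om_gt0) (le_trans ler01 C1).
  rewrite /K /K1; clearbody C; move: a_gt0 om_gt0 C1; lra.
have K0 : 0 < K by exact: lt_le_trans K1'.
(* [perturbation_bound] at level [eta] yields the factor [eta * K], which has to be at most
   [eps]. *)
pose eta := Num.min 1 (eps / K).
have eta0 : 0 < eta by rewrite /eta lt_min ltr01 divr_gt0.
have etaK : eta * K <= eps by rewrite -ler_pdivlMr// /eta ge_min lexx orbT.
have etae : eta <= eps by rewrite (le_trans _ etaK)// ler_peMr// ltW.
have eta1 : eta <= 1 by rewrite /eta ge_min lexx.
have NS0 : N k.+1 @[k --> \oo] --> (0 : R) by rewrite (cvg_shiftS N).
near=> k.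
have bg : beta k <= gamma k by near: k.
have g0 : 0 < gamma k by exact: lt_le_trans bg.
have ge : gamma k <= eta.
  by rewrite -(gtr0_norm g0); near: k; exact: cvg0_near_le.
have Ne : `|N k| <= eta.
  by near: k; exact: cvg0_near_le.
have Ne' : `|N k.+1| <= eta.
  by near: k; exact: (cvg0_near_le NS0).
have L0 : 0 <= 1 + `|x k| + `|u k| by rewrite !addr_ge0.
have := @perturbation_bound R a om c (gamma k) (beta k) (xi k) (N k) (N k.+1)
  (x k) (u k) eta a_gt0 om_gt0 (beta_gt0 k) bg (ltW eta0) eta1 (xi_le1 k) ge Ne Ne'.
have -> : u k - N k * (x k + c) = y k by rewrite /u addrK.
rewrite -yS -/(s k) -/(r k) => -[sL rL].
split => //; first exact: le_trans etae.
  by apply: (le_trans sL); rewrite ler_wpM2r.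
by apply: (le_trans rL); rewrite ler_wpM2r.
Unshelve. all: by end_near. Qed.

Lemma one_timescale_cvg : (forall k, beta k = gamma k) -> x @ \oo --> (0 : R).
Proof.
move=> bgE; have a0 := a_gt0; have om0 := om_gt0.
pose Q x u := a * x ^+ 2 + u ^+ 2 / 2 + (u + om * x) ^+ 2 / 2.
have Qx z v : a * z ^+ 2 <= Q z v.
  by rewrite /Q; have := sqr_ge0 v; have := sqr_ge0 (v + om * z); lra.
have Q0 z v : 0 <= Q z v.
  by rewrite (le_trans _ (Qx z v))// mulr_ge0 ?sqr_ge0// ltW.
suff V0 : (fun k => Q (x k) (u k)) @ \oo --> (0 : R).
  apply/cvgrPdist_le => e e0.
  have e2 : 0 < a * e ^+ 2 by rewrite mulr_gt0// exprn_gt0.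
  have := cvg0_near_le V0 e2.
  apply: filterS => k; rewrite sub0r normrN (ger0_norm (Q0 _ _)) => Qe.
  have := le_trans (Qx _ _) Qe; rewrite ler_pM2l// -real_normK ?num_real//.
  by rewrite ler_pXn2r ?nnegrE// ltW.
apply: (@eventual_descent_cvg0 _ _ beta) => // [k|delta d0]; first exact: ltW.
pose C1 := 2 * a + 1 + (1 + om) ^+ 2.
pose C2 := 4 * a + (a + om + 1) ^+ 2.
pose kap := Num.min 1 a.
pose C4 := a + 2 + om ^+ 2.
have C40 : 0 < C4 by rewrite /C4; have := sqr_ge0 om; lra.
have kap0 : 0 < kap by rewrite lt_min ltr01.
have QC4 z v : Q z v <= C4 * (z ^+ 2 + v ^+ 2).
  have h : (v + om * z) ^+ 2 / 2 <= v ^+ 2 + om ^+ 2 * z ^+ 2.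
    by have := sqr_ge0 (v - om * z); rewrite !expr2; lra.
  have := sqr_ge0 z; have := sqr_ge0 v; have := sqr_ge0 om; rewrite /Q /C4 => o v0 z0.
  have := mulr_ge0 o v0; have := mulr_ge0 (ltW a_gt0) v0; move: h; lra.
(* The error is at most [theta * (1 + m)]. Its part in [m] takes half of the dissipation
   [om * kap * m]; when [Q] exceeds [delta / 2], the other half is at least [2 * c'], and
   [theta <= c'] leaves [c']. *)
pose c' := om * kap * delta / (8 * C4).
have c'0 : 0 < c' by rewrite divr_gt0 ?mulr_gt0.
pose theta := Num.min (om * kap / 2) (Num.min c' (delta / 2)).
have theta0 : 0 < theta by rewrite !lt_min c'0 ?divr_gt0 ?mulr_gt0.
pose D := 3 * C1 + 3 * C2.
have C10 : 0 < C1 by rewrite /C1; have := sqr_ge0 (1 + om); lra.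
have C20 : 0 < C2 by rewrite /C2; have := sqr_ge0 (a + om + 1); lra.
have D0 : 0 < D by rewrite /D; lra.
pose eps := Num.min 1 (theta / D).
have eps0 : 0 < eps by rewrite lt_min ltr01 divr_gt0.
have eps1 : eps <= 1 by rewrite ge_min lexx.
have epsD : D * eps <= theta by rewrite mulrC -ler_pdivlMr// ge_min lexx orbT.
exists c' => //; apply: filterS (small eps0) => k [bg ge sL rL].
have be1 : beta k <= eps by rewrite bgE.
have step := @one_timescale_step R a om eps (beta k) (x k) (u k) (r k) (s k)
  a_gt0 om_gt0 (ltW eps0) eps1 (beta_gt0 k) rL sL.
rewrite -/(Q _ _) -/(Q (x k) (u k)) -/C1 -/C2 in step.
set m := x k ^+ 2 + u k ^+ 2 in step.
have m0 : 0 <= m by rewrite addr_ge0 ?sqr_ge0.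
have kapm : kap * m <= u k ^+ 2 + a * x k ^+ 2.
  have := ler_wpM2r (sqr_ge0 (u k)) (_ : kap <= 1).
  have := ler_wpM2r (sqr_ge0 (x k)) (_ : kap <= a).
  rewrite /m !ge_min !lexx orbT => /(_ isT) h1 /(_ isT) h2; lra.
have th : 3 * C1 * eps + 3 * C2 * beta k <= theta.
  apply: (le_trans _ epsD); move: (ler_wpM2l (ltW C20) be1).
  by rewrite /D; clearbody eps C1 C2; lra.
have step' : Q (x k.+1) (u k.+1) <=
    Q (x k) (u k) - beta k * (om * kap / 2 * m - theta).
  rewrite xSE (uS bg) -bgE; apply: (le_trans step).
  have h1 : om * (kap * m) <= om * (u k ^+ 2 + a * x k ^+ 2).
    by rewrite ler_wpM2l// ltW.
  have h2 : (3 * C1 * eps + 3 * C2 * beta k) * (1 + m) <= theta * (1 + m).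
    by rewrite ler_wpM2r// addr_ge0.
  have h3 : theta * m <= om * kap / 2 * m.
    by rewrite ler_wpM2r// ge_min lexx.
  have key : - (om * (u k ^+ 2 + a * x k ^+ 2)) +
      (3 * C1 * eps + 3 * C2 * beta k) * (1 + m) <= - (om * kap / 2 * m - theta).
    lra.
  by move: (ler_wpM2l (ltW (beta_gt0 k)) key); lra.
(* Splitting at [delta / 2] leaves room for one step: from below it, [Q] can rise by at most
   [delta / 2]. *)
rewrite /= le_max; have [Vd|dV] := leP (Q (x k) (u k)) (delta / 2).
  apply/orP; left; apply: (le_trans step').
  have h : 0 <= om * kap / 2 * m by rewrite mulr_ge0// divr_ge0// ltW// mulr_gt0.
  have h1 : beta k * theta <= delta / 2.
    rewrite -[leRHS]mul1r; apply: ler_pM.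
    - exact: ltW (beta_gt0 k).
    - exact: ltW.
    - exact: le_trans be1 eps1.
    - by rewrite !ge_min lexx !orbT.
  have := mulr_ge0 (ltW (beta_gt0 k)) h; move: h1 Vd; lra.
apply/orP; right; apply: (le_trans step'); rewrite lerD2l lerN2 mulrC.
rewrite ler_wpM2l ?(ltW (beta_gt0 k))//.
have thc : theta <= c' by rewrite !ge_min lexx !orbT.
have : 2 * c' <= om * kap / 2 * m.
  have mge : delta / (2 * C4) <= m.
    rewrite ler_pdivrMr ?mulr_gt0//.
    by have := lt_le_trans dV (QC4 _ _); rewrite -/m; lra.
  have -> : 2 * c' = om * kap / 2 * (delta / (2 * C4)).
    by rewrite /c'; field; rewrite gt_eqF.
  by rewrite ler_wpM2l// divr_ge0// ltW// mulr_gt0.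
lra.
Qed.

Lemma two_timescale_cvg : beta k / gamma k @[k --> \oo] --> 0 -> x @ \oo --> (0 : R).
Proof.
move=> bg0; have a0 := a_gt0; have om0 := om_gt0.
(* For frozen [x] the fast variable [u] has equilibrium [- b * x]; [w] is its deviation from it. *)
pose b := a / om; have b0 : 0 < b by rewrite divr_gt0.
have abom : a = b * om by rewrite /b divfK// gt_eqF.
pose w k := u k + b * x k.
pose V k := Num.max `|x k| (4 / b * `|w k|).
have xV k : `|x k| <= V k by rewrite /V le_max lexx.
have V0 k : 0 <= V k by exact: le_trans (xV k).
suff cV : V @ \oo --> (0 : R).
  apply/cvgrPdist_le => e e0; have := cvg0_near_le cV e0.
  apply: filterS => k; rewrite sub0r normrN (ger0_norm (V0 k)).
  exact: le_trans.
apply: (@eventual_descent_cvg0 _ _ beta) => // [k|delta d0]; first exact: ltW.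
pose D := 1 / delta + 1 + b / 4 + b.
have D0 : 0 < D by rewrite /D; have := divr_gt0 ltr01 d0; lra.
(* Each entry secures one smallness hypothesis of [two_timescale_step]; those with [1 / om] and
   [1 / b] keep the contraction factors nonnegative. *)
pose eps := Num.min (Num.min 1 (Num.min (1 / om) (1 / b)))
  (Num.min (b / 4 / D) (b * om / 16 / D)).
have b4 : 0 < b / 4 by rewrite divr_gt0.
have bo16 : 0 < b * om / 16 by apply: divr_gt0 => //; exact: mulr_gt0.
have eps0 : 0 < eps.
  rewrite !lt_min ltr01 (divr_gt0 ltr01 om0) (divr_gt0 ltr01 b0).
  by rewrite (divr_gt0 b4 D0) (divr_gt0 bo16 D0).
pose eta := om / (32 * D).
have eta0 : 0 < eta by apply: divr_gt0 => //; exact: mulr_gt0.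
have e1 : eps <= 1 by rewrite !ge_min lexx.
have eom : eps * om <= 1 by rewrite -ler_pdivlMr// !ge_min lexx !orbT.
have eb : eps * b <= 1 by rewrite -ler_pdivlMr// !ge_min lexx !orbT.
have eD : eps * D <= b / 4 by rewrite -ler_pdivlMr// !ge_min lexx !orbT.
have eDo : eps * D <= b * om / 16 by rewrite -ler_pdivlMr// !ge_min lexx !orbT.
have eta_near : \forall k \near \oo, beta k / gamma k <= eta.
  have := cvg0_near_le bg0 eta0.
  by apply: filterS => k; apply: le_trans; exact: ler_norm.
pose c' := Num.min (b / 2 * delta) (om / 2 * delta).
have c'0 : 0 < c'.
  by rewrite lt_min; apply/andP; split; apply: mulr_gt0 => //; exact: divr_gt0.
exists c' => //; apply: filterS2 eta_near (small eps0) => k bgeta [bg ge sL rL].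
have g0 : 0 < gamma k by exact: lt_le_trans bg.
have := @two_timescale_step R b om D delta eps eta (beta k) (gamma k) (x k) (w k)
  (r k) (s k) b0 om_gt0 d0 erefl (ltW eps0) e1 eD.
have -> : w k - b * x k = u k by rewrite /w addrK.
move=> /(_ _ (beta_gt0 k) bg _ _ _ _ rL sL) [].
- by move: eDo; lra.
- by rewrite -ler_pdivrMr.
- by rewrite /eta; have -> : 32 * (om / (32 * D)) * D = om by field; rewrite gt_eqF.
- by apply: le_trans eom; rewrite ler_wpM2r// ltW.
- by apply: le_trans eb; rewrite ler_wpM2r// ?(le_trans bg)// ltW.
rewrite -xSE -/(V k).
have -> : w k - gamma k * om * w k + gamma k * r k + b * beta k * (u k + s k) = w k.+1.
  by rewrite [w k.+1]/w (uS bg) xSE /w abom; ring.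
move=> hx hw; set M := Num.max (V k) delta in hx hw.
have hc z : c' <= z -> M - beta k * z <= M - c' * beta k.
  by move=> cz; rewrite lerD2l lerN2 mulrC ler_wpM2l// ltW.
have VM : V k.+1 <= M - c' * beta k.
  rewrite /V ge_max; apply/andP; split.
    by apply: (le_trans hx); apply: hc; rewrite ge_min lexx.
  by apply: (le_trans hw); apply: hc; rewrite ge_min lexx orbT.
apply: (le_trans VM); rewrite /M le_max.
have [_|_] := leP (V k) delta; last by rewrite lexx orbT.
by rewrite gerBl mulr_ge0// ltW.
Qed.

End recursion.

(** * Series of independent bits *)

Section bernoulli_series.
Context {d : measure_display} {T : measurableType d} {R : realType}.
Variables (P : probability T R) (b : nat -> T -> bool) (q : R).
Hypotheses (q_ge0 : 0 <= q) (q_le1 : q <= 1).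
Hypothesis b_measurable : forall i, measurable [set w | b i w].

Let cyl (c : nat -> pred bool) j := [set w | forall i, (i < j)%N -> c i (b i w)].

Hypothesis b_independent : forall j (c : nat -> pred bool),
  P (cyl c j `&` [set w | ~~ b j w]) = (q%:E * P (cyl c j))%E.

Variable gamma : nat -> R.

Let xi i w : R := (b i w)%:R - (1 - q).

Let cyl_measurable c j : measurable (cyl c j).
Proof. by apply: measurable_bits => i _; exact: b_measurable. Qed.

Let walk w m n := \sum_(m <= i < m + n) gamma i * xi i w.

(** The offset [x] makes the event recursive: revealing bit [m] leaves the same kind of event from
    [m.+1] with a shifted offset. *)
Let exceeds (eps : R) m n x : set T :=
  [set w | exists2 l, (l <= n)%N & eps < `|x + walk w m l|].

Let walk0 w m : walk w m 0 = 0.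
Proof. by rewrite /walk addn0 big_geq. Qed.

Let walkS w m l : walk w m l.+1 = gamma m * xi m w + walk w m.+1 l.
Proof. by rewrite /walk addnS big_nat_recl ?leq_addr// big_add1. Qed.

Let exceedsS eps m n x : `|x| <= eps ->
  exceeds eps m n.+1 x =
    ([set w | b m w] `&` exceeds eps m.+1 n (x + gamma m * q)) `|`
    ([set w | ~~ b m w] `&` exceeds eps m.+1 n (x - gamma m * (1 - q))).
Proof.
move=> xe; have xT w l : b m w ->
    x + walk w m l.+1 = x + gamma m * q + walk w m.+1 l.
  by move=> bm; rewrite walkS /xi bm /=; ring.
have xF w l : ~~ b m w ->
    x + walk w m l.+1 = x - gamma m * (1 - q) + walk w m.+1 l.
  by move=> bm; rewrite walkS /xi (negbTE bm) /=; ring.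
apply/seteqP; split => w /=.
  move=> [[|l]]; first by rewrite walk0 addr0 ltNge xe.
  move=> ln; case: (boolP (b m w)) => bm el.
    by left; split => //; exists l; rewrite // -xT.
  by right; split => //; exists l; rewrite // -xF.
move=> [] [bm [l ln el]]; exists l.+1 => //; first by rewrite xT.
by rewrite xF.
Qed.

Let bN_measurable i : measurable [set w | ~~ b i w].
Proof.
rewrite (_ : [set w | _] = ~` [set w | b i w]); first exact: measurableC.
by apply/seteqP; split => w /= /negP.
Qed.

Let exceeds_measurable eps m n x : measurable (exceeds eps m n x).
Proof.
elim: n m x => [|n IH] m x; have [xe|ex] := leP `|x| eps.
- rewrite (_ : exceeds _ _ _ _ = set0)//; apply/seteqP; split => // w [l].
  by rewrite leqn0 => /eqP ->; rewrite walk0 addr0 ltNge xe.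
- rewrite (_ : exceeds _ _ _ _ = setT)//; apply/seteqP; split => // w _.
  by exists 0%N => //; rewrite walk0 addr0.
- by rewrite exceedsS//; apply: measurableU; apply: measurableI.
- rewrite (_ : exceeds _ _ _ _ = setT)//; apply/seteqP; split => // w _.
  by exists 0%N => //; rewrite walk0 addr0.
Qed.

(* Kolmogorov's maximal inequality; the induction peels off the first bit, for
   which the bound for the two shifted walks averages to the wanted one. *)
Let maximal eps m n x c : 0 < eps ->
  fine (P (cyl c m `&` exceeds eps m n x)) <=
  fine (P (cyl c m)) *
    ((x ^+ 2 + \sum_(m <= i < m + n) gamma i ^+ 2) / eps ^+ 2).
Proof.
move=> e0; have e2 : 0 < eps ^+ 2 by rewrite exprn_gt0.
have S0 k l : 0 <= \sum_(k <= i < l) gamma i ^+ 2.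
  by apply: sumr_ge0 => i _; exact: sqr_ge0.
(* A start already beyond [eps] makes the bound trivial, since its last factor is then at least
   1. *)
have far k l y c' : eps < `|y| -> fine (P (cyl c' k `&` exceeds eps k l y)) <=
    fine (P (cyl c' k)) * ((y ^+ 2 + \sum_(k <= i < k + l) gamma i ^+ 2) / eps ^+ 2).
  move=> ey; apply: (@le_trans _ _ (fine (P (cyl c' k)))).
    rewrite fine_le ?fin_num_measure//; first exact: measurableI.
    by apply: le_measure; rewrite ?inE//; exact: measurableI.
  rewrite ler_peMr ?fine_ge0//.
  rewrite ler_pdivlMr// mul1r (@le_trans _ _ (y ^+ 2)) ?lerDl//.
  by rewrite -[leRHS](real_normK (num_real y)) lerXn2r ?nnegrE// ltW.
elim: n m x c => [|n IH] m x c; have [xe|] := leP `|x| eps; try exact: far.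
  rewrite (_ : exceeds _ _ _ _ = set0).
    rewrite setI0 measure0/= mulr_ge0 ?fine_ge0// divr_ge0 ?(ltW e2)//.
    by rewrite addr_ge0 ?sqr_ge0.
  apply/seteqP; split => // w [l].
  by rewrite leqn0 => /eqP ->; rewrite walk0 addr0 ltNge xe.
pose cb (e : bool) i : pred bool := if i == m then eq_op^~ e else c i.
have cbE e : cyl (cb e) m.+1 = cyl c m `&` [set w | b m w == e].
  apply/seteqP; split => w /=.
    move=> cw; split => [i im|].
      by have := cw i (ltnW im); rewrite /cb (ltn_eqF im).
    by have := cw m (ltnSn m); rewrite /cb eqxx.
  move=> [cw bm] i; rewrite ltnS leq_eqVlt => /predU1P[->|im].
    by rewrite /cb eqxx.
  by rewrite /cb (ltn_eqF im) cw.
have cbT : cyl c m `&` [set w | b m w] = cyl (cb true) m.+1.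
  by rewrite cbE; congr (_ `&` _); apply/seteqP; split => w /=; rewrite eqb_id.
have cbF : cyl c m `&` [set w | ~~ b m w] = cyl (cb false) m.+1.
  by rewrite cbE; congr (_ `&` _); apply/seteqP; split => w /=; rewrite eqbF_neg.
have PF : fine (P (cyl (cb false) m.+1)) = q * fine (P (cyl c m)).
  by rewrite -cbF b_independent fineM ?fin_num_measure.
have PT : fine (P (cyl (cb true) m.+1)) = (1 - q) * fine (P (cyl c m)).
  rewrite mulrBl mul1r -PF; apply/eqP; rewrite eq_sym subr_eq; apply/eqP.
  rewrite -fineD ?fin_num_measure// -cbT -cbF -measureU.
  - rewrite -setIUr (_ : _ `|` _ = setT) ?setIT//.
    by apply/seteqP; split => // w _ /=; case: (b m w); [left|right].
  - exact: measurableI.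
  - exact: measurableI.
  - by apply/seteqP; split => // w [[_ /= ->] [_ //]].
have mI e y : measurable (cyl (cb e) m.+1 `&` exceeds eps m.+1 n y).
  exact: measurableI.
rewrite exceedsS// setIUr !setIA cbT cbF measureU//; last first.
  apply/seteqP; split => // w [[+ _] [+ _]].
  by rewrite -cbT -cbF /= => -[_ ->] [_].
rewrite fineD ?fin_num_measure//.
apply: (le_trans (lerD (IH _ _ _) (IH _ _ _))).
rewrite PT PF !addSn -addnS [in leRHS]big_ltn ?addnS ?ltnS ?leq_addr//.
set Sg := \sum_(_ <= _ < _) _; rewrite -subr_ge0.
set f := fine _; set g := gamma m.
(* The step is centred, so averaging the squared offsets adds only its variance
   [g ^+ 2 * (q * (1 - q))], which is at most the allotted [g ^+ 2]. *)
rewrite (_ : _ - _ = f * (g ^+ 2 * (1 - q * (1 - q))) / eps ^+ 2).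
  rewrite divr_ge0 ?(ltW e2)// mulr_ge0 ?fine_ge0// mulr_ge0 ?sqr_ge0//.
  by move: (mulr_ge0 q_ge0 q_ge0) q_le1; lra.
by field; rewrite gt_eqF.
Qed.

(** Letting the horizon grow in the maximal inequality bounds the probability that partial sums ever
    move more than [eps] after [m] by a tail of the series of squares. These tails vanish, so almost
    surely the partial sums are Cauchy. *)
Lemma bernoulli_series_cvg : (\sum_(0 <= k <oo) (gamma k ^+ 2)%:E < +oo)%E ->
  {ae P, forall w, cvgn (series (fun i => gamma i * xi i w))}.
Proof.
move=> goo.
have g20 k : (0 <= (gamma k ^+ 2)%:E)%E by rewrite lee_fin sqr_ge0.
pose Y eps m := \bigcup_n exceeds eps m n 0.
have mY eps m : measurable (Y eps m) by exact: bigcupT_measurable.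
have PY eps m : 0 < eps ->
    (P (Y eps m) <= (eps ^- 2)%:E * \sum_(m <= k <oo) (gamma k ^+ 2)%:E)%E.
  move=> e0.
  (* Continuity from below carries the finite-horizon bound to the infinite horizon. *)
  have cY : P (exceeds eps m n 0) @[n --> \oo] --> P (Y eps m).
    apply: nondecreasing_cvg_mu => // [|i j ij].
      exact: mY.
    apply/subsetPset => w [l li el]; exists l => //; exact: leq_trans ij.
  rewrite -(cvg_lim _ cY)//; apply: lime_le; first by apply/cvg_ex; exists (P (Y eps m)).
  apply: nearW => n.
  have := @maximal eps m n 0 (fun=> predT) e0.
  have -> : cyl (fun=> predT) m = setT by apply/seteqP; split.
  rewrite setTI probability_setT mul1r expr0n add0r => h.
  rewrite -(fineK (fin_num_measure P _ (exceeds_measurable eps m n 0))).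
  apply: (@le_trans _ _ ((\sum_(m <= i < m + n) gamma i ^+ 2) / eps ^+ 2)%:E).
    by rewrite lee_fin.
  rewrite EFinM muleC lee_pmul2l//; last by rewrite lte_fin invr_gt0 exprn_gt0.
  rewrite -sumEFin (nneseries_split m n)//.
  by rewrite leeDl// nneseries_ge0.
have PcapY eps : 0 < eps -> P (\bigcap_m Y eps m) = 0%E.
  move=> e0; apply/eqP; rewrite eq_le measure_ge0 andbT.
  have ct : ((eps ^- 2)%:E * \sum_(m <= k <oo) (gamma k ^+ 2)%:E)%E @[m --> \oo] --> 0%E.
    have tl := @nneseries_tail_cvg R (fun k => (gamma k ^+ 2)%:E) xpredT goo
      (fun k _ => g20 k).
    by have := cvgeZl (isT : (eps ^- 2)%:E \is a fin_num) tl; rewrite mule0.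
  rewrite -(cvg_lim _ ct)//; apply: lime_ge; first by apply/cvg_ex; exists 0%E.
  apply: nearW => m; apply: (le_trans _ (PY eps m e0)).
  apply: le_measure; rewrite ?inE//; first exact: bigcapT_measurable.
  exact: bigcap_inf.
exists (\bigcup_r \bigcap_m Y (r.+1%:R^-1) m); split.
- by apply: bigcupT_measurable => r; exact: bigcapT_measurable.
- apply/negligibleP.
    by apply: bigcupT_measurable => r; exact: bigcapT_measurable.
  apply: negligible_bigcup => r; apply/negligibleP; first exact: bigcapT_measurable.
  by apply: PcapY; rewrite invr_gt0.
move=> w /= nc; apply: contrapT => nY; apply: nc.
apply/cauchy_cvgP; apply: cauchy_exP => eps e0.
have [r re] : exists r : nat, r.+1%:R^-1 < eps.
  exists (Num.bound eps^-1); rewrite invf_plt ?posrE//.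
  rewrite (lt_trans (archi_boundP _))// ?ltr_nat// ltW// invr_gt0.
  done.
have [m nYm] : exists m, ~ Y (r.+1%:R^-1) m w.
  apply: contrapT => H; apply: nY; exists r => // m _.
  by apply: contrapT => nYm; apply: H; exists m.
exists (series (fun i => gamma i * xi i w) m); exists m => // n /= mn.
rewrite /ball/= distrC; apply: le_lt_trans re; rewrite leNgt; apply/negP => el.
apply: nYm; exists (n - m)%N => //; exists (n - m)%N => //.
rewrite add0r /walk subnKC//.
by move: el; rewrite sub_series_geq.
Qed.

End bernoulli_series.

(** * The SAM iteration along one path *)

Lemma nneseries_lty_cvg0 (R : realType) (f : nat -> R) :
  (forall k, 0 <= f k) -> (\sum_(0 <= k <oo) (f k)%:E < +oo)%E ->
  f @ \oo --> (0 : R).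
Proof.
move=> f0 foo; apply: cvg_series_cvg_0; apply: nondecreasing_is_cvgn.
  by apply/nondecreasing_seqP => n; rewrite /series/= big_nat_recr//= lerDl.
have fin : (\sum_(0 <= k <oo) (f k)%:E)%E \is a fin_num.
  by rewrite ge0_fin_numE// nneseries_ge0// => k _ _; rewrite lee_fin.
exists (fine (\sum_(0 <= k <oo) (f k)%:E)%E) => _ [n _ <-].
rewrite -lee_fin fineK// /series/= -sumEFin.
by apply: nneseries_lim_ge => k _ _; rewrite lee_fin.
Qed.

(** Dividing the momentum by [beta k] turns it into [(1 - omega * gamma k) * y k], and the mean of
    the bracket in the iteration is affine with root [Delta] and slope [- q]. *)
Lemma sam_cvg (R : realType) (p Delta omega bm1 zm1 z0 : R) (beta eta : nat -> R)
    (I : nat -> R) (b : nat -> bool) :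
  let gamma k := eta k / beta k in
  let q := p / (p + Delta) in
  0 < Delta -> 0 < p -> 0 < omega -> 0 < bm1 ->
  (forall k, 0 < beta k) -> (forall k, 0 < eta k) ->
  (\sum_(0 <= k <oo) (beta k)%:E = +oo)%E ->
  (\sum_(0 <= k <oo) (gamma k ^+ 2)%:E < +oo)%E ->
  (forall k, beta k = gamma k) \/ beta k / gamma k @[k --> \oo] --> (0 : R) ->
  (forall k, I k.+1 = (b k)%:R) ->
  cvgn (series (fun k => gamma k * ((b k)%:R - (1 - q)))) ->
  sam p omega bm1 zm1 z0 beta eta I k @[k --> \oo] --> Delta.
Proof.
move=> gamma q D0 p0 om0 bm0 b0 e0 boo g2 bg Ib cN.
pose z k := sam p omega bm1 zm1 z0 beta eta I k.
(* At [k = 0] this is [zm1], matched by [bm1] in [beta_prev], so the linear recursion holds from the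
   first step. *)
pose zp k := (sam_pair p omega bm1 zm1 z0 beta eta I k).1.
pose x k := z k - Delta.
pose y k := (z k - zp k) / beta_prev bm1 beta k.
pose xi k : R := (b k)%:R - (1 - q).
have g0 k : 0 < gamma k by rewrite divr_gt0.
have pD : 0 < p + Delta by rewrite addr_gt0.
have q0 : 0 < q by rewrite divr_gt0.
have q1 : q < 1 by rewrite ltr_pdivrMr// mul1r ltrDl.
have bp0 k : 0 < beta_prev bm1 beta k by case: k => [|k] /=.
have zpS k : zp k.+1 = z k.
  by rewrite /zp /z /sam /=; case: sam_pair.
have zS k : z k.+1 = z k + eta k * (I k.+1 * (z k + p) - z k) +
    zeta_seq omega bm1 beta eta k * (z k - zp k).
  by rewrite /z /zp /sam /=; case: sam_pair.
have yS k : y k.+1 =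
    y k + gamma k * (- q * x k - omega * y k + xi k * (x k + (Delta + p))).
  rewrite /y zpS zS Ib /= /zeta_seq /x /xi /gamma /q.
  by field; rewrite !gt_eqF.
have xS k : x k.+1 = x k + beta k * y k.+1.
  by rewrite /x /y zpS /= mulrC divfK ?gt_eqF//; ring.
have xi1 k : `|xi k| <= 1.
  by rewrite /xi ler_norml; case: (b k) => /=; lra.
have cg : gamma @ \oo --> (0 : R).
  apply/cvgrPdist_le => e ep.
  have := cvg0_near_le (nneseries_lty_cvg0 (fun k => sqr_ge0 (gamma k)) g2)
    (exprn_gt0 2 ep).
  apply: filterS => k; rewrite sub0r normrN normrX => ge.
  by rewrite -(@ler_pXn2r _ 2) ?nnegrE// ltW.
have bleg : \forall k \near \oo, beta k <= gamma k.
  case: bg => [bg|bg]; first by apply: nearW => k; rewrite bg.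
  have := cvg0_near_le bg ltr01; apply: filterS => k /(le_trans (ler_norm _)).
  by rewrite ler_pdivrMr// mul1r.
have x0 : x @ \oo --> (0 : R).
  case: bg => bg.
    exact: (@one_timescale_cvg R q omega (Delta + p) beta gamma xi x y).
  exact: (@two_timescale_cvg R q omega (Delta + p) beta gamma xi x y).
have : x k + Delta @[k --> \oo] --> 0 + Delta.
  by apply: cvgD => //; exact: cvg_cst.
by rewrite add0r; under eq_fun do rewrite subrK.
Qed.

Theorem theorem3 (d : measure_display) (T : measurableType d) (R : realType)
  (P : probability T R) (Delta p : R)
  (S : nat -> {RV P >-> R}) (A : nat -> {RV P >-> R})
  (omega bm1 zm1 z0 : R) (beta eta : nat -> R) :
  0 < Delta -> 0 < p ->
  (forall j, @is_exponential _ _ _ P Delta (S j)) ->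
  (forall k, @is_exponential _ _ _ P p (A k)) ->
  @mutually_independent _ _ _ P _
    (fun i : nat + nat => match i with inl j => S j | inr k => A k end) ->
  0 < omega -> 0 < bm1 -> (forall k, 0 < beta k) -> (forall k, 0 < eta k) ->
  let gamma := fun k => eta k / beta k in
  ( ((\sum_(0 <= k <oo) (beta k)%:E = +oo)%E /\
     (\sum_(0 <= k <oo) (beta k ^+ 2)%:E < +oo)%E /\
     (forall k, beta k = gamma k))
  \/
    ((\sum_(0 <= k <oo) (beta k)%:E = +oo)%E /\
     (\sum_(0 <= k <oo) (gamma k)%:E = +oo)%E /\
     (\sum_(0 <= k <oo) (beta k ^+ 2 + gamma k ^+ 2)%:E < +oo)%E /\
     (beta k / gamma k @[k --> \oo] --> 0)) ) ->
  {ae P, forall w,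
    sam p omega bm1 zm1 z0 beta eta
      (fun k => change_indicator (fun j => S j : T -> R) (fun k => A k : T -> R) k w) k
      @[k --> \oo] --> Delta}.
Proof.
move=> D0 p0 eS eA ind om0 bm0 b0 e0 gamma H.
pose q := p / (p + Delta).
have q0 : 0 <= q by rewrite divr_ge0 ?addr_ge0// ltW.
have q1 : q <= 1 by rewrite ler_pdivrMr ?addr_gt0// mul1r lerDl ltW.
have boo : (\sum_(0 <= k <oo) (beta k)%:E = +oo)%E by case: H => [[]|[]].
have g2 : (\sum_(0 <= k <oo) (gamma k ^+ 2)%:E < +oo)%E.
  case: H => [[_ [b2 bg]]|[_ [_ [bg2 _]]]].
    by under eq_eseriesr do rewrite -bg.
  apply: le_lt_trans bg2; apply: lee_nneseries => k _.
    by rewrite lee_fin sqr_ge0.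
  by rewrite lee_fin lerDr sqr_ge0.
have bg : (forall k, beta k = gamma k) \/ beta k / gamma k @[k --> \oo] --> (0 : R).
  by case: H => [[_ [_ ?]]|[_ [_ [_ ?]]]]; [left|right].
have := @bernoulli_series_cvg _ _ _ P (change_bit S A) q q0 q1
  (change_bit_measurable S A)
  (fun j c => no_change_prob D0 p0 eS eA ind j c) gamma g2.
apply: filterS => w cw.
(* The indicator of index [k.+1] looks at the interval starting at t_k, which is bit [k]. *)
by apply: (@sam_cvg R p Delta omega bm1 zm1 z0 beta eta _ (change_bit S A ^~ w)) => // k;
  rewrite /change_indicator /change_bit /=; case: asboolP.
Qed.
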